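(* Let $\mathcal{C}$ be a class of graphs and $k'\ge 1$ an integer. Suppose there is an algorithm that computes, for every graph $G\in\mathcal{C}$, a family $\mathcal{V}(G)$ of vertex sets of $G$ such that: the assignment $G\mapsto\mathcal{V}(G)$ is isomorphism invariant, $\mathcal{V}(G)$ has width at most $k'$, and $\mathcal{V}(G)$ captures a semi-smooth tree decomposition of $G$. Then isomorphism of graphs in $\mathcal{C}$ can be decided with the $(k'+3)$-dimensional Weisfeiler-Lehman algorithm restricted to $\mathcal{V}(G)$: two graphs $G,G'\in\mathcal{C}$ are isomorphic if and only if the multisets of stable colors $\{\!\{\mathrm{wl}^{k}_\infty[\mathcal{V}(G),G](\bar v)\}\!\}$ and $\{\!\{\mathrm{wl}^{k}_\infty[\mathcal{V}(G'),G'](\bar v')\}\!\}$ (over all $k$-tuples, $k=k'+3$) coincide.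
   Context: Graphs are finite, simple, undirected. An assignment $G\mapsto\mathcal{V}(G)$ of families of vertex sets is isomorphism invariant if for every isomorphism $\pi:G_1\to G_2$ we have $\mathcal{V}(G_2)=\pi(\mathcal{V}(G_1))$. A family of sets has width $k'$ if its largest set has size $k'$ (width at most $k'$: all sets have size at most $k'$). Restricted $k$-dimensional Weisfeiler-Lehman refinement ($k\ge k'$, $k\ge2$): given a graph $G$ and a family $\mathcal{V}$ of vertex sets of width at most $k'$, let $\mathcal{V}^+$ be the set of $k$-tuples $(v_1,\dots,v_k)$ of vertices (entries not necessarily distinct) with $\{v_1,\dots,v_{k'}\}\in\mathcal{V}$. For tuples in $\mathcal{V}^+$, $\mathrm{wl}^k_0(v_1,\dots,v_k)$ is the isomorphism type of the ordered tuple (two tuples get the same color iff $v_i\mapsto v_i'$ is an isomorphism of the induced (colored) subgraphs); for tuples not in $\mathcal{V}^+$ every color $\mathrm{wl}^k_i$ is $\emptyset$. For $i\ge0$ and tuples in $\mathcal{V}^+$, $\mathrm{wl}^k_{i+1}(v_1,\dots,v_k)=(\mathrm{wl}^k_i(v_1,\dots,v_k),M)$ where $M$ is the multiset $\{\!\{(\mathrm{wl}^k_i(x,v_2,\dots,v_k),\mathrm{wl}^k_i(v_1,x,v_3,\dots,v_k),\dots,\mathrm{wl}^k_i(v_1,\dots,v_{k-1},x)) : x\in V(G)\}\!\}$. $\mathrm{wl}^k_\infty$ is $\mathrm{wl}^k_i$ for the least $i$ at which the induced partition of tuples equals that of step $i+1$. Colors are compared across the two graphs. A tree decomposition of $G$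 is a pair $(\{X_i\}_{i\in I},T=(I,F))$ with $T$ a tree, every vertex in some bag, every edge contained in some bag, and for each vertex the bags containing it forming a connected subtree. A family $\mathcal{V}(G)$ captures a tree decomposition if every bag of it belongs to $\mathcal{V}(G)$. A tree decomposition is semi-smooth if for adjacent bags $X_i,X_j$ one has $|X_i\cap X_j|\ge \max(|X_i|,|X_j|)-1$. *)

(* Defs.v *)
From HB Require Import structures.
From mathcomp Require Import all_boot.
From mathcomp Require Import finmap multiset.

Set Implicit Arguments.
Unset Strict Implicit.
Unset Printing Implicit Defensive.

Local Open Scope mset_scope.
Local Open Scope nat_scope.

Record sgraph := SGraph {
  vertex :> finType;
  edge : rel vertex;
  edge_sym : symmetric edge;
  edge_irrefl : irreflexive edge }.

Definition is_iso (G H : sgraph) (f : G -> H) : Prop :=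
  bijective f /\ {mono f : x y / edge x y}.

Definition isomorphic (G H : sgraph) : Prop := exists f : G -> H, is_iso f.

Definition set_family (G : sgraph) := {set {set G}}.

Definition width_at_most (G : sgraph) (w : nat) (V : set_family G) : Prop :=
  forall S : {set G}, S \in V -> #|S| <= w.

(* [V] assigns a family to every graph, but is constrained only on [C]: its
   values elsewhere are irrelevant. *)
Definition iso_invariant (C : sgraph -> Prop) (V : forall G, set_family G) : Prop :=
  forall G H : sgraph, C G -> C H ->
  forall f : G -> H, is_iso f -> V H = [set f @: S | S : {set G} in V G].

Definition connected_in (T : sgraph) (A : {set T}) : Prop :=
  {in A &, forall s t : T,
     connect [rel x y | [&& x \in A, y \in A & edge x y]] s t}.

Definition is_tree (T : sgraph) : Prop :=
  [/\ 0 < #|T|, connected_in [set: T]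
    & forall c : seq T, 2 < size c -> ~ ucycle (@edge T) c].

Definition tree_decomposition (G T : sgraph) (X : T -> {set G}) : Prop :=
  [/\ is_tree T,
      forall v : G, exists i : T, v \in X i,
      forall u v : G, edge u v -> exists i : T, (u \in X i) && (v \in X i)
    & forall v : G, connected_in [set i : T | v \in X i]].

(* The truncation of [.-1] at 0 is harmless: the bound then says nothing. *)
Definition semi_smooth (G T : sgraph) (X : T -> {set G}) : Prop :=
  forall i j : T, edge i j -> (maxn #|X i| #|X j|).-1 <= #|X i :&: X j|.

Definition captures (G T : sgraph) (V : set_family G) (X : T -> {set G}) : Prop :=
  forall i : T, X i \in V.

(* Isomorphism types of ordered [k]-tuples of vertices: the equality pattern
   and the adjacency pattern of the tuple (see [iso_typeP]). *)
Definition isotype (k : nat) : choiceType :=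
  {ffun 'I_k * 'I_k -> bool * bool} : choiceType.

Definition iso_type (G : sgraph) (k : nat) (v : {ffun 'I_k -> G}) : isotype k :=
  [ffun p => (v p.1 == v p.2, edge (v p.1) (v p.2))].

Lemma iso_typeP (G H : sgraph) (k : nat)
    (u : {ffun 'I_k -> G}) (v : {ffun 'I_k -> H}) : 0 < k ->
  iso_type u = iso_type v <->
  exists f : G -> H,
    [/\ forall i, f (u i) = v i,
        {in codom u &, injective f}
      & {in codom u &, {mono f : x y / edge x y}}].
Proof.
move=> k_gt0; split=> [uv | [f [fu f_inj f_mono]]]; last first.
  apply/ffunP=> -[i j]; rewrite !ffunE /= -!fu f_mono ?codom_f //.
  by rewrite (inj_in_eq f_inj) ?codom_f.
have uvE i j : (u i == u j) = (v i == v j) /\ edge (u i) (u j) = edge (v i) (v j).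
  by have /ffunP/(_ (i, j)) := uv; rewrite !ffunE /= => -[-> ->].
pose f x := v (odflt (Ordinal k_gt0) [pick i | u i == x]).
have fu i : f (u i) = v i.
  rewrite /f; case: pickP => [j | /(_ i)]; last by rewrite eqxx.
  by rewrite (uvE j i).1 => /eqP.
exists f; split=> // _ _ /codomP[i ->] /codomP[j ->]; rewrite !fu.
  by move=> /eqP; rewrite -(uvE i j).1 => /eqP.
by rewrite (uvE i j).2.
Qed.

(* [None] is the color of the tuples outside [Vplus]. *)
Fixpoint color (k i : nat) : choiceType :=
  match i with
  | 0 => option (isotype k) : choiceType
  | i.+1 => option (color k i * {mset {ffun 'I_k -> color k i}}) : choiceType
  end.

Section WL.

Variables (w k : nat).

Definition subst (G : sgraph) (v : {ffun 'I_k -> G}) (j : 'I_k) (x : G)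
    : {ffun 'I_k -> G} :=
  [ffun l => if l == j then x else v l].

Definition Vplus (G : sgraph) (V : set_family G) : {set {ffun 'I_k -> G}} :=
  [set v : {ffun 'I_k -> G} | [set v i | i : 'I_k & i < w] \in V].

Fixpoint wl (G : sgraph) (V : set_family G) (i : nat) : {ffun 'I_k -> G} -> color k i :=
  match i with
  | 0 => fun v => if v \in Vplus V then Some (iso_type v) else None
  | i.+1 => fun v =>
      if v \in Vplus V then
        Some (wl V i v,
              seq_mset [seq [ffun j => wl V i (subst v j x)] | x : G])
      else None
  end.

(* Since colors are compared across two graphs, the partition whose
   stabilization is tested is that of the [k]-tuples of both graphs. Stopping
   as soon as the two partitions are separately stable would be wrong: equal
   colors of that round may still split differently in the next one. *)
Definition wl_pair (G H : sgraph) (V : set_family G) (W : set_family H) (i : nat)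
    (p : {ffun 'I_k -> G} + {ffun 'I_k -> H}) : color k i :=
  match p with inl v => wl V i v | inr v => wl W i v end.

Definition stable (G H : sgraph) (V : set_family G) (W : set_family H) (i : nat) : bool :=
  [forall p, forall q,
    (wl_pair V W i p == wl_pair V W i q)
    == (wl_pair V W i.+1 p == wl_pair V W i.+1 q)].

Lemma wl_pair_refines (G H : sgraph) (V : set_family G) (W : set_family H) i p q :
  wl_pair V W i.+1 p = wl_pair V W i.+1 q -> wl_pair V W i p = wl_pair V W i q.
Proof.
have wl_None (K : sgraph) (U : set_family K) v : v \notin Vplus U ->
  wl U i v = match i with 0 => None | _ => None end.
  by case: i => [|i] /negbTE /= ->.
case: p q => p [] q /=.
all: case: ifP => Hp; case: ifP => Hq //; first by case.
all: by rewrite !wl_None ?Hp ?Hq.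
Qed.

Lemma stable_exists (G H : sgraph) (V : set_family G) (W : set_family H) :
  exists i, stable V W i.
Proof.
pose E i := [set pq | wl_pair V W i pq.1 == wl_pair V W i pq.2].
pose N := #|E 0|.
suff /existsP[i st_i] : [exists i : 'I_N.+1, stable V W i] by exists i.
apply: contraT => /existsPn nst.
have bound i : i <= N.+1 -> #|E i| + i <= N.
  elim: i => [|i IHi] lt_i; first by rewrite addn0.
  rewrite addnS (leq_trans _ (IHi (ltnW lt_i))) // ltn_add2r proper_card //.
  rewrite properE; apply/andP; split.
    by apply/subsetP=> pq; rewrite !inE => /eqP/wl_pair_refines->.
  apply: contra (nst (Ordinal lt_i)) => /subsetP sE.
  apply/forallP=> p; apply/forallP=> q.
  suff -> : (wl_pair V W i p == wl_pair V W i q) =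
            (wl_pair V W i.+1 p == wl_pair V W i.+1 q) by [].
  apply/idP/idP; last first.
    by move=> /eqP/wl_pair_refines->.
  by move=> Epq; have := sE (p, q); rewrite !inE; apply.
by have := bound _ (leqnn _); rewrite addnS ltnNge leq_addl.
Qed.

Definition stable_round (G H : sgraph) (V : set_family G) (W : set_family H) : nat :=
  ex_minn (stable_exists V W).

Definition wl_infty (G H : sgraph) (V : set_family G) (W : set_family H)
    (p : {ffun 'I_k -> G} + {ffun 'I_k -> H}) : color k (stable_round V W) :=
  wl_pair V W (stable_round V W) p.

Definition same_stable_colors (G H : sgraph) (V : set_family G) (W : set_family H)
    : Prop :=
  seq_mset [seq wl_infty V W (inl v) | v : {ffun 'I_k -> G}] =
  seq_mset [seq wl_infty V W (inr v) | v : {ffun 'I_k -> H}].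

End WL.

(* Main.v *)
Require Import Defs.
From mathcomp Require Import all_boot.
From mathcomp Require multiset.

Set Implicit Arguments.
Unset Strict Implicit.
Unset Printing Implicit Defensive.

(** Read equality of stable colors as a bijective pebble game: the first [k']
    pebbles occupy a set of the family, the other three are free. On a graph minus
    a bag, the free pebbles recognize connected components. Let [S] be a bag and [D]
    a component of [G - S] with a neighbour in [S]. Following the tree towards [D],
    one slides the bag pebbles from [S] to the next bag, which by semi-smoothness
    differs by at most one vertex; by induction on the branch of the tree, the color
    of [S] together with a vertex of [D] determines [G[S + D]] up to isomorphism.
    Components with equal colors are matched greedily, because bijections of the
    game preserve the number of vertices of each color in a component.

    A slide needs two adjacent bags to share a vertex, so this only recovers the
    components of [G] touched by a given bag. For a component [K] away from the root
    bag of the tree, the first bag meeting [K] contains a single vertex [b] of it.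
    As the family is invariant under automorphisms of [G], all copies of [K] look
    alike from the rest of that bag, and moving the pebble on [b] counts them. *)

(** * Bijections from equal cardinals and equal multisets *)

Lemma card_bijection (A B : finType) : #|A| = #|B| -> exists f : A -> B, bijective f.
Proof.
move=> eAB; exists (fun x => enum_val (cast_ord eAB (enum_rank x))).
exists (fun y => enum_val (cast_ord (esym eAB) (enum_rank y))) => x.
  by rewrite enum_valK cast_ordK enum_rankK.
by rewrite enum_valK cast_ordKV enum_rankK.
Qed.

(** Turns equal multisets of colors into a move of the bijective game: [perm_iotaP] yields a
    permutation of indices, read through the enumerations of [A] and [B]. *)
Lemma perm_map_bijection (A B : finType) (C : eqType) (F : A -> C) (F' : B -> C) :
  perm_eq [seq F x | x : A] [seq F' y | y : B] ->
  exists2 f : A -> B, bijective f & forall x, F x = F' (f x).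
Proof.
move=> pFF'; have sAB : #|A| = #|B| by have := perm_size pFF'; rewrite !size_image.
have [h0 _] := card_bijection sAB.
have [A0|[a0 _]] := set_0Vmem [set: A].
  have noA (a : A) : False by have := in_setT a; rewrite A0 inE.
  exists h0; last by move=> x; case: (noA x).
  by apply: inj_card_bij; [move=> x; case: (noA x) | rewrite -sAB].
have /(perm_iotaP (F a0))[Is pIs eIs] := pFF'.
have sIs : size Is = #|B| by rewrite (perm_size pIs) size_iota size_image.
have inIs i : i < #|A| -> nth 0 Is i < #|B|.
  move=> lt_i; have : nth 0 Is i \in Is by rewrite mem_nth // sIs -sAB.
  by rewrite (perm_mem pIs) mem_iota size_image.
pose f x := enum_val (Ordinal (inIs (enum_rank x) (ltn_ord _))).
exists f.
  apply: inj_card_bij; last by rewrite sAB.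
  move=> x y /enum_val_inj[] /eqP.
  rewrite nth_uniq ?sIs -?sAB ?ltn_ord //; last by rewrite (perm_uniq pIs) iota_uniq.
  by move=> /eqP/val_inj/enum_rank_inj.
move=> x; have := congr1 (nth (F a0) ^~ (enum_rank x)) eIs.
rewrite (nth_map 0) ?sIs -?sAB ?ltn_ord // (nth_map a0) -?cardE ?ltn_ord //.
rewrite -enum_val_nth enum_rankK => ->; rewrite (nth_map (h0 a0)) -?cardE ?inIs ?ltn_ord //.
by rewrite /f (enum_val_nth (h0 a0)).
Qed.

(** * Components and partial isomorphisms *)

Section Components.

Variable G : sgraph.
Implicit Types (J : {set G}) (x y z : G).

Definition avoid J : rel G := fun x y => [&& x \notin J, y \notin J & edge x y].

(* The component of [x] in [G - J]; it is [[set x]] when [x \in J]. *)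
Definition cmp J x : {set G} := [set y | connect (avoid J) x y].

Lemma avoid_sym J : connect_sym (avoid J).
Proof. by apply: sym_connect_sym => x y; rewrite /avoid edge_sym andbCA. Qed.

Lemma cmp_refl J x : x \in cmp J x.
Proof. by rewrite inE. Qed.

Lemma cmp_sym J x y : (x \in cmp J y) = (y \in cmp J x).
Proof. by rewrite !inE avoid_sym. Qed.

Lemma cmp_eq J x y : y \in cmp J x -> cmp J y = cmp J x.
Proof. by rewrite inE => xy; apply/setP=> z; rewrite !inE (same_connect (avoid_sym J) xy). Qed.

Lemma cmp_trans J x y z : y \in cmp J x -> z \in cmp J y -> z \in cmp J x.
Proof. by move=> /cmp_eq->. Qed.

Lemma cmp_step J x y z :
  y \in cmp J x -> y \notin J -> z \notin J -> edge y z -> z \in cmp J x.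
Proof.
move=> xy yJ zJ yz; apply: cmp_trans xy _; by rewrite inE connect1 // /avoid yJ zJ.
Qed.

Lemma cmp_ind J x (P : G -> Prop) : P x ->
  (forall y z, P y -> y \notin J -> z \notin J -> edge y z -> P z) ->
  forall y, y \in cmp J x -> P y.
Proof.
move=> Px PS y; rewrite inE => /connectP[p]; elim: p x Px => /= [|z p IHp] x Px.
  by move=> _ ->.
by case/andP=> /and3P[xJ zJ xz] /IHp; apply; apply: PS xz.
Qed.

Lemma cmp_notin J x y : x \notin J -> y \in cmp J x -> y \notin J.
Proof. by move=> xJ; move: y; apply: cmp_ind. Qed.

Lemma cmp_sub J J' x : J' \subset J -> cmp J x \subset cmp J' x.
Proof.
move=> sJ; apply/subsetP; apply: cmp_ind => [|y z xy yJ zJ yz]; first exact: cmp_refl.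
by apply: cmp_step yz; rewrite // (contra (subsetP sJ _)).
Qed.

(** A component depends only on the separator vertices adjacent to it: [J'] may replace [J] if it
    keeps these and does not meet the component. *)
Lemma cmp_change J J' x :
    (forall a d, a \in J -> d \in cmp J x -> edge a d -> a \in J') ->
    (forall d, d \in cmp J x -> d \notin J') -> x \notin J ->
  cmp J' x = cmp J x.
Proof.
move=> JJ' disj xJ; apply/eqP; rewrite eqEsubset; apply/andP; split; apply/subsetP.
  apply: cmp_ind => [|y z xy _ zJ' yz]; first exact: cmp_refl.
  apply: (cmp_step xy _ _ yz); first exact: cmp_notin xJ xy.
  by apply: contra zJ' => zJ; apply: JJ' zJ xy _; rewrite edge_sym.
move=> y xy; have [] // : y \in cmp J x /\ y \in cmp J' x.
move: y xy; apply: cmp_ind => [|y z [xy xy'] yJ zJ yz]; first by rewrite !cmp_refl.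
have xz : z \in cmp J x by apply: cmp_step yz.
by split=> //; apply: cmp_step (yz); rewrite ?disj.
Qed.

(** Without such an edge, the component in [G - J] would stay inside the one in [G - J'], which
    cannot contain [e]. This supplies an attaching edge when a component breaks up at a new bag. *)
Lemma cmp_adjacent J J' x e :
    x \notin J -> x \notin J' -> e \in J' -> e \in cmp J x ->
  exists s d, [/\ s \in J', s \in cmp J x, d \in cmp J' x & edge s d].
Proof.
move=> xJ xJ' eJ' eD.
have [/existsP[s /existsP[d /and4P[sJ' sD dx sd]]]|none] :=
  boolP [exists s, exists d, [&& s \in J', s \in cmp J x, d \in cmp J' x & edge s d]].
  by exists s, d.
suff sub y : y \in cmp J x -> y \in cmp J' x.
  by have := cmp_notin xJ' (sub e eD); rewrite eJ'.
move=> xy; have [] // : y \in cmp J x /\ y \in cmp J' x.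
move: y xy; apply: cmp_ind => [|y z [xy xy'] yJ zJ yz]; first by rewrite !cmp_refl.
have xz : z \in cmp J x by apply: cmp_step yz.
split=> //; apply: (cmp_step xy' (cmp_notin xJ' xy') _ yz); apply/negP=> zJ'.
case/existsP: none; exists z; apply/existsP; exists y.
by rewrite zJ' xz xy' edge_sym.
Qed.

End Components.

Section PartialIso.

Variables G H : sgraph.
Implicit Types (P Q Z : {set G}) (phi : G -> H).

Definition iso_on Z phi :=
  [forall x in Z, forall y in Z,
    ((phi x == phi y) == (x == y)) && (edge (phi x) (phi y) == edge x y)].

Lemma iso_onP Z phi :
  reflect {in Z &, forall x y, (phi x == phi y) = (x == y) /\
                               edge (phi x) (phi y) = edge x y}
          (iso_on Z phi).
Proof.
apply: (iffP forall_inP) => [isoZ x y xZ yZ | isoZ x xZ].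
  by have /forall_inP/(_ y yZ)/andP[/eqP-> /eqP->] := isoZ x xZ.
by apply/forall_inP=> y yZ; have [-> ->] := isoZ x y xZ yZ; rewrite !eqxx.
Qed.

Lemma iso_on_inj Z phi : iso_on Z phi -> {in Z &, injective phi}.
Proof. by move=> /iso_onP isoZ x y xZ yZ /eqP; rewrite (isoZ x y xZ yZ).1 => /eqP. Qed.

Lemma iso_onS P Q phi : P \subset Q -> iso_on Q phi -> iso_on P phi.
Proof.
move=> /subsetP sPQ /iso_onP isoQ; apply/iso_onP=> x y xP yP.
by apply: isoQ; apply: sPQ.
Qed.

Lemma eq_iso_on Z phi psi : {in Z, phi =1 psi} -> iso_on Z phi -> iso_on Z psi.
Proof.
move=> eqZ /iso_onP isoZ; apply/iso_onP=> x y xZ yZ.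
by rewrite -!eqZ //; apply: isoZ.
Qed.

Definition piecewise P phi psi x : H := if x \in P then phi x else psi x.

Lemma piecewise_iso P Q phi psi :
    iso_on P phi -> iso_on Q psi ->
    {in P :&: Q, phi =1 psi} ->
    (forall x y, x \in P :\: Q -> y \in Q :\: P ->
      [/\ ~~ edge x y, phi x != psi y & ~~ edge (phi x) (psi y)]) ->
  iso_on (P :|: Q) (piecewise P phi psi).
Proof.
move=> /iso_onP isoP /iso_onP isoQ agree cross.
have mP x : x \in P -> piecewise P phi psi x = phi x by rewrite /piecewise => ->.
have mQ x : x \in Q -> piecewise P phi psi x = psi x.
  by rewrite /piecewise; case: ifP => // xP xQ; rewrite agree // inE xP.
have mixed x y : x \in P :\: Q -> y \in Q :\: P ->
    [/\ (piecewise P phi psi x == piecewise P phi psi y) = (x == y), (x == y) = false,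
        edge x y = false & edge (piecewise P phi psi x) (piecewise P phi psi y) = false].
  move=> xPQ yQP; have [/negbTE xy /negbTE fxy /negbTE exy] := cross x y xPQ yQP.
  move: xPQ yQP; rewrite !inE => /andP[xQ xP] /andP[yP yQ].
  rewrite (mP x) // (mQ y) // xy fxy exy; split=> //; last first.
    by apply/eqP=> exy'; rewrite exy' yQ in xQ.
  by apply/esym/eqP=> exy'; rewrite exy' yQ in xQ.
apply/iso_onP=> x y; rewrite !in_setU.
case xP: (x \in P); case xQ: (x \in Q); case yP: (y \in P); case yQ: (y \in Q) => //= _ _.
all: try by rewrite !mP //; apply: isoP.
all: try by rewrite !mQ //; apply: isoQ.
  by have [||-> _ -> ->] := mixed x y; rewrite ?inE ?xP ?xQ ?yP ?yQ.
have [||+ e1 e2 e3] := mixed y x; rewrite ?inE ?xP ?xQ ?yP ?yQ //.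
by rewrite e1 eq_sym => ->; rewrite eq_sym e1 edge_sym e3 edge_sym e2.
Qed.

End PartialIso.

Lemma iso_on_id (G : sgraph) (Z : {set G}) : iso_on Z id.
Proof. by apply/iso_onP. Qed.

(** The two walks join [j] to [i] through [t] without using the edge [ij]; a simple path extracted
    from them closes with this edge to a cycle. *)
Lemma tree_edge_cut (T : sgraph) (i j t : T) :
  is_tree T -> edge i j -> t \in cmp [set i] j -> t \in cmp [set j] i -> False.
Proof.
move=> [_ _ acyclic] ij jt it.
pose e : rel T := fun x y => edge x y && ~~ ((i \in [:: x; y]) && (j \in [:: x; y])).
have e_sym : connect_sym e.
  by apply: sym_connect_sym => x y; rewrite /e edge_sym !inE orbC [(j == x) || _]orbC.
have ji : connect e j i.
  apply: (@connect_trans _ _ t).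
    move: jt; rewrite inE; apply: connect_sub => x y.
    rewrite /avoid !inE => /and3P[xi yi xy]; apply: connect1.
    by rewrite /e xy !inE ![i == _]eq_sym (negbTE xi) (negbTE yi).
  move: it; rewrite e_sym inE; apply: connect_sub => x y.
  rewrite /avoid !inE => /and3P[xj yj xy]; apply: connect1.
  by rewrite /e xy !inE ![j == _]eq_sym (negbTE xj) (negbTE yj) andbF.
have /connectP[p0 /shortenP[p pP p_uniq _] last_p] := ji.
apply: (acyclic (j :: p)); last first.
  rewrite /ucycle p_uniq andbT /= rcons_path -last_p ij andbT.
  by apply: sub_path pP => x y /andP[].
(* A cycle needs three vertices: a path of length 0 would give [i = j], and one of length 1 would be
   the edge deleted in [e]. *)
case: p {p_uniq} pP last_p => [|x [|y p]] //= => [_ ij'|].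
  by rewrite ij' edge_irrefl in ij.
by move=> + xi; rewrite -xi /e !inE !eqxx orbT andbF.
Qed.

(** Induction on [#|A|], matching one component at a time. Counting provides [x'] with the color of
    [b]; the components of [b] and [x'] contain each color equally often, so deleting both preserves
    the inequalities. One representative [b] per component suffices, as the whole component is
    mapped at once. *)
Lemma glue (G H : sgraph) (S : {set G}) (S' : {set H}) (sigma : G -> H)
    (Col : eqType) (chi : G -> Col) (chi' : H -> Col) (A : {set G}) (A' : {set H}) :
    iso_on S sigma ->
    [disjoint A & S] -> [disjoint A' & S'] ->
    {in A, forall x, cmp S x \subset A} -> {in A', forall x, cmp S' x \subset A'} ->
    {in A, forall x, exists2 b, b \in cmp S x &
       #|[set y in A | chi y == chi b]| <= #|[set y in A' | chi' y == chi b]|} ->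
    {in A & A', forall x x', chi x = chi' x' -> exists phi : G -> H,
      [/\ iso_on (S :|: cmp S x) phi, {in S, phi =1 sigma},
          {in cmp S x, forall y, phi y \in cmp S' x'}
        & forall c, #|[set y in cmp S x | chi y == c]| =
                    #|[set y in cmp S' x' | chi' y == c]|]} ->
  exists phi : G -> H,
    [/\ iso_on (S :|: A) phi, {in S, phi =1 sigma}
      & {in A, forall y, phi y \in A'}].
Proof.
move=> isoS; have [n leAn] := ubnP #|A|; elim: n => // n IHn in A A' leAn *.
move=> dAS dAS' clA clA' count ext.
have [->|[x xA]] := set_0Vmem A.
  by exists sigma; split=> [||x]; rewrite ?setU0 ?inE.
have [b bx leA] := count x xA; have bA := subsetP (clA x xA) b bx.
have [x' x'A' /eqP chix'] : exists2 x', x' \in A' & chi' x' == chi b.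
  have : 0 < #|[set y in A' | chi' y == chi b]|.
    by apply: leq_trans leA; apply/card_gt0P; exists b; rewrite inE bA eqxx.
  by case/card_gt0P=> x'; rewrite inE => /andP[]; exists x'.
have [phi1 [iso1 phi1S phi1E cardE]] := ext b x' bA x'A' (esym chix').
set E := cmp S b in iso1 phi1E cardE; set E' := cmp S' x' in phi1E cardE.
have sEA : E \subset A by apply: clA.
have sEA' : E' \subset A' by apply: clA'.
have AS y : y \in A -> y \notin S by move=> yA; rewrite (disjointFr dAS yA).
have AS' y : y \in A' -> y \notin S' by move=> yA; rewrite (disjointFr dAS' yA).
have cardD (K : sgraph) (B F : {set K}) (P : pred K) : F \subset B ->
    #|[set y in B :\: F | P y]| = #|[set y in B | P y]| - #|[set y in F | P y]|.
  move=> sFB; rewrite -cardsDS.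
    by apply: eq_card => y; rewrite !inE; case: (P y); rewrite ?andbT ?andbF.
  by apply/subsetP=> y; rewrite !inE => /andP[/(subsetP sFB)-> ->].
have clD (K : sgraph) (R B : {set K}) z : {in B, forall x, cmp R x \subset B} ->
    {in B :\: cmp R z, forall x, cmp R x \subset B :\: cmp R z}.
  move=> clB y; rewrite inE => /andP[zy yB].
  rewrite subsetD clB //=; apply/pred0P=> u /=; apply/negP=> /andP[yu zu].
  by case/negP: zy; rewrite (cmp_trans zu) // cmp_sym.
have [||||||| phi2 [iso2 phi2S phi2A]] := IHn (A :\: E) (A' :\: E').
- rewrite -ltnS; apply: leq_trans leAn; rewrite ltnS proper_card //.
  rewrite properE subsetDl; apply/subsetPn; exists b => //.
  by rewrite in_setD negb_and negbK cmp_refl.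
- by apply: disjointWl dAS; apply: subsetDl.
- by apply: disjointWl dAS'; apply: subsetDl.
- exact: clD.
- exact: clD.
- move=> y; rewrite inE => /andP[yE yA]; have [b' b'y le'] := count y yA.
  by exists b'; rewrite // !cardD // cardE leq_sub2r.
- move=> y y'; rewrite !inE => /andP[_ yA] /andP[_ yA']; exact: ext.
exists (piecewise (S :|: E) phi1 phi2).
have -> : S :|: A = (S :|: E) :|: (S :|: (A :\: E)).
  apply/setP=> y; rewrite !(in_setU, in_setD); have := subsetP sEA y.
  by case: (y \in S); case: (y \in E); case: (y \in A) => // /(_ isT).
split.
- apply: piecewise_iso => // [y | y z].
    rewrite !(in_setU, in_setD, in_setI); case yS: (y \in S) => /=; first by rewrite phi1S ?phi2S.
    by case: (y \in E).
  rewrite !(in_setU, in_setD, in_setI) => yP zQ.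
  have [yS yE] : y \notin S /\ y \in E.
    by move: yP; case: (y \in S); case: (y \in E); rewrite ?andbF.
  have [zA zE] : z \in A /\ z \notin E.
    by move: zQ; case: (z \in S); case: (z \in A); case: (z \in E).
  have := phi2A z; rewrite !(in_setU, in_setD, in_setI) zE zA => /(_ isT)/andP[zE' zA'].
  have yE' := phi1E y yE; split.
  + apply: contra zE => yz; apply: (cmp_step yE yS (AS z zA) yz).
  + by apply: contraNneq zE' => <-.
  + apply: contra zE' => yz; apply: (cmp_step yE' _ (AS' _ zA') yz).
    exact/AS'/(subsetP sEA').
- by move=> y yS; rewrite /piecewise in_setU yS /= phi1S.
- move=> y yA; rewrite /piecewise in_setU (negbTE (AS y yA)) /=.
  case: ifPn => yE; first exact/(subsetP sEA')/phi1E.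
  by have := phi2A y; rewrite !(in_setU, in_setD, in_setI) yE yA => /(_ isT)/andP[].
Qed.

(** * The bijective pebble game *)

Section Bisimulation.

Variables w k : nat.

Definition bag_pos : {set 'I_k} := [set l : 'I_k | l < w].

Lemma in_Vplus (G : sgraph) (V : set_family G) (v : {ffun 'I_k -> G}) :
  (v \in Vplus w k V) = (v @: bag_pos \in V).
Proof.
rewrite inE; suff -> : [set v i | i : 'I_k & i < w] = v @: bag_pos by [].
by apply/setP=> x; apply/imsetP/imsetP=> -[l lw ->]; exists l; rewrite // inE in lw *.
Qed.

Lemma substE (G : sgraph) (v : {ffun 'I_k -> G}) j x l :
  subst v j x l = if l == j then x else v l.
Proof. by rewrite ffunE. Qed.

(** An invariant for Duplicator. One bijection answers the moves of every pebble [j], because a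
    round of refinement records the vector of colors over all [j]. Outside [Vplus] all colors
    coincide, so only membership is compared. *)
Definition bisim (G H : sgraph) (V : set_family G) (W : set_family H)
    (R : {ffun 'I_k -> G} -> {ffun 'I_k -> H} -> Prop) : Prop :=
  forall u v, R u v ->
    (u \in Vplus w k V) = (v \in Vplus w k W) /\
    (u \in Vplus w k V -> iso_type u = iso_type v /\
      exists2 f : G -> H, bijective f &
        forall j x, R (subst u j x) (subst v j (f x))).

Lemma bisim_sym (G H : sgraph) (V : set_family G) (W : set_family H) R :
  bisim V W R -> bisim W V (fun v u => R u v).
Proof.
move=> bisR v u uv; have [eqV bis] := bisR u v uv; split; first by rewrite eqV.
rewrite -eqV => uV; have [-> [f f_bij fR]] := bis uV; split=> //.
have [g gK fK] := f_bij; exists g; first by exists f.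
by move=> j y; rewrite -{2}[y]fK.
Qed.

Lemma wl_pair_round0 (G H : sgraph) (V : set_family G) (W : set_family H) i
    (p q : {ffun 'I_k -> G} + {ffun 'I_k -> H}) :
  wl_pair w V W i p = wl_pair w V W i q -> wl_pair w V W 0 p = wl_pair w V W 0 q.
Proof. by elim: i => // i IHi /wl_pair_refines/IHi. Qed.

(** At the stable round, equal colors stay equal one round later; unfolding that extra round yields
    the bijection, and descending to round 0 yields the isomorphism type. *)
Lemma wl_bisim (G H : sgraph) (V : set_family G) (W : set_family H) :
  let r := stable_round w k V W in
  bisim V W (fun u v => wl w V r u = wl w W r v).
Proof.
move=> r u v uv.
have /forallP/(_ (inl u))/forallP/(_ (inr v))/eqP/esym st : stable w k V W r.
  by rewrite /r /stable_round; case: ex_minnP.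
have /eqP uv1 : wl_pair w V W r.+1 (inl u) == wl_pair w V W r.+1 (inr v).
  by rewrite st; apply/eqP.
have uv0 : wl_pair w V W 0 (inl u) = wl_pair w V W 0 (inr v).
  exact: wl_pair_round0 uv1.
have eqV : (u \in Vplus w k V) = (v \in Vplus w k W).
  by move: uv1 => /=; do 2 case: ifP.
split=> // uV; split; first by move: uv0; rewrite /= -eqV uV => -[].
move: uv1 => /=; rewrite -eqV uV => -[_ /multiset.eq_seq_msetP/perm_map_bijection[f f_bij fE]].
by exists f => // j x; have /ffunP/(_ j) := fE x; rewrite !ffunE.
Qed.

Lemma iso_typeE (G H : sgraph) (u : {ffun 'I_k -> G}) (v : {ffun 'I_k -> H}) i j :
  iso_type u = iso_type v ->
  (u i == u j) = (v i == v j) /\ edge (u i) (u j) = edge (v i) (v j).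
Proof. by move=> /ffunP/(_ (i, j)); rewrite !ffunE => -[]. Qed.

Lemma iso_type_mem (G H : sgraph) (u : {ffun 'I_k -> G}) (v : {ffun 'I_k -> H})
    (J : {set 'I_k}) i :
  iso_type u = iso_type v -> (u i \in u @: J) = (v i \in v @: J).
Proof.
move=> uv; apply/imsetP/imsetP => -[l lJ /eqP].
  by rewrite (iso_typeE _ _ uv).1 => /eqP; exists l.
by rewrite -(iso_typeE _ _ uv).1 => /eqP; exists l.
Qed.

(** Moving pebble [j] onto pebble [l] makes the two coincide, so the isomorphism type of the new
    tuple, visible as it stays in [Vplus], forces the answer [v l]. *)
Lemma bisim_copy (G H : sgraph) (V : set_family G) (W : set_family H) R u v j l :
    bisim V W R -> R u v -> u \in Vplus w k V -> subst u j (u l) \in Vplus w k V ->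
  R (subst u j (u l)) (subst v j (v l)).
Proof.
move=> bisR uv uV u'V; have [_ /(_ uV)[_ [f _ fR]]] := bisR u v uv.
have fRl := fR j (u l); have [_ /(_ u'V)[iso _]] := bisR _ _ fRl.
case: (eqVneq j l) => [->|jl] in fRl iso *.
  have substK (K : sgraph) (s : {ffun 'I_k -> K}) : subst s l (s l) = s.
    by apply/ffunP=> m; rewrite substE; case: eqP => // ->.
  by rewrite !substK.
have := (iso_typeE j l iso).1; rewrite !substE eqxx [l == j]eq_sym (negbTE jl) eqxx.
by move=> /esym/eqP<-.
Qed.

Lemma wl_iso (G H : sgraph) (V : set_family G) (W : set_family H) (f : G -> H) i
    (v : {ffun 'I_k -> G}) :
    is_iso f -> W = [set f @: S | S : {set G} in V] ->
  wl w V i v = wl w W i [ffun l => f (v l)].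
Proof.
move=> [f_bij f_mono] defW; have f_inj := bij_inj f_bij.
have inV (u : {ffun 'I_k -> G}) : ([ffun l => f (u l)] \in Vplus w k W) = (u \in Vplus w k V).
  rewrite !in_Vplus defW -(mem_imset _ _ (imset_inj f_inj)) -imset_comp.
  by have /eq_imset-> : [ffun l => f (u l)] =1 f \o u by move=> l; rewrite ffunE.
elim: i v => [|i IHi] v /=; rewrite inV; case: ifP => // vV; congr Some.
  by apply/ffunP=> p; rewrite !ffunE f_mono (inj_eq f_inj).
rewrite -IHi; congr pair; apply/multiset.eq_seq_msetP.
have [g gK fK] := f_bij.
have -> : [seq [ffun j => wl w V i (subst v j x)] | x : G] =
          [seq [ffun j => wl w W i (subst [ffun l => f (v l)] j y)]
             | y <- [seq f x | x : G]].
  rewrite -map_comp; apply: eq_map => x; apply/ffunP=> j /=; rewrite !ffunE IHi.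
  by congr (wl _ _ _ _); apply/ffunP=> l; rewrite !ffunE; case: ifP.
apply: perm_map; apply: uniq_perm; rewrite ?map_inj_uniq -?enumT ?enum_uniq //.
by move=> y; rewrite mem_enum inE; apply/mapP; exists (g y); rewrite ?mem_enum ?fK.
Qed.

End Bisimulation.

Lemma isomorphic_same_colors (w k : nat) (G H : sgraph)
    (V : set_family G) (W : set_family H) (f : G -> H) :
    is_iso f -> W = [set f @: S | S : {set G} in V] ->
  same_stable_colors w k V W.
Proof.
move=> f_iso defW; apply/multiset.eq_seq_msetP; have [[g gK fK] _] := f_iso.
have -> : [seq wl_infty w V W (inl v) | v : {ffun 'I_k -> G}] =
          [seq wl_infty w V W (inr v)
             | v <- [seq [ffun l => f (u l)] | u : {ffun 'I_k -> G}]].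
  by rewrite -map_comp; apply: eq_map => v; rewrite /wl_infty /= (wl_iso _ _ _ f_iso defW).
have inj_comp : injective (fun u : {ffun 'I_k -> G} => [ffun l => f (u l)]).
  by move=> u v /ffunP uv; apply/ffunP=> l; have := uv l; rewrite !ffunE => /(can_inj gK).
apply: perm_map; apply: uniq_perm; rewrite ?map_inj_uniq -?enumT ?enum_uniq //.
move=> v; rewrite mem_enum inE; apply/mapP; exists [ffun l => g (v l)].
  by rewrite mem_enum.
by apply/ffunP=> l; rewrite !ffunE fK.
Qed.

(** * Recognizing components with three free pebbles *)

Section Game.

Variable w : nat.
Local Notation k := (w + 3).

Definition free1 : 'I_k := rshift w (@Ordinal 3 0 isT).
Definition free2 : 'I_k := rshift w (@Ordinal 3 1 isT).
Definition free3 : 'I_k := rshift w (@Ordinal 3 2 isT).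

Local Notation F := (bag_pos w k).

Lemma freeP (l : 'I_k) : [\/ l \in F, l = free1, l = free2 | l = free3].
Proof.
rewrite inE; case: (ltnP l w) => [lw | wl]; first by constructor 1.
have : l - w < 3 by rewrite ltn_subLR.
have lE : l = w + (l - w) :> nat by rewrite subnKC.
case: (l - w) lE => [|[|[|//]]] lE _; [constructor 2|constructor 3|constructor 4];
  exact: val_inj.
Qed.

Lemma free1N : free1 \notin F. Proof. by rewrite inE /= addn0 ltnn. Qed.
Lemma free2N : free2 \notin F. Proof. by rewrite inE /= -leqNgt leq_addr. Qed.
Lemma free3N : free3 \notin F. Proof. by rewrite inE /= -leqNgt leq_addr. Qed.

Lemma free_neq :
  ((free1 == free2) = false) * ((free1 == free3) = false) * ((free2 == free3) = false) *
  ((free2 == free1) = false) * ((free3 == free1) = false) * ((free3 == free2) = false).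
Proof. by rewrite -!val_eqE /= !eqn_add2l. Qed.

Lemma imset_subst_free (G : sgraph) (u : {ffun 'I_k -> G}) l x (J : {set 'I_k}) :
  J \subset F -> l \notin F -> subst u l x @: J = u @: J.
Proof.
move=> /subsetP JF lF; apply: eq_in_imset => m mJ; rewrite substE.
by case: eqP => // ml; rewrite -ml JF in lF.
Qed.

Lemma Vplus_subst_free (G : sgraph) (V : set_family G) (u : {ffun 'I_k -> G}) l x :
  l \notin F -> (subst u l x \in Vplus w k V) = (u \in Vplus w k V).
Proof. by move=> lF; rewrite !in_Vplus imset_subst_free. Qed.

(** With all free pebbles on [x], the color of [spread u x] is a color of the vertex [x] relative to
    the bag alone. *)
Definition spread (G : sgraph) (u : {ffun 'I_k -> G}) (x : G) : {ffun 'I_k -> G} :=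
  [ffun l => if l \in F then u l else x].

Lemma spread_bag (G : sgraph) (u : {ffun 'I_k -> G}) x l : l \in F -> spread u x l = u l.
Proof. by move=> lF; rewrite ffunE lF. Qed.

Lemma spread_free (G : sgraph) (u : {ffun 'I_k -> G}) x l : l \notin F -> spread u x l = x.
Proof. by move=> /negbTE lF; rewrite ffunE lF. Qed.

Lemma eq_spread (G : sgraph) (u v : {ffun 'I_k -> G}) x :
  {in F, u =1 v} -> spread u x = spread v x.
Proof. by move=> uv; apply/ffunP=> l; rewrite !ffunE; case: ifP => // /uv. Qed.

Lemma imset_spread (G : sgraph) (u : {ffun 'I_k -> G}) x (J : {set 'I_k}) :
  J \subset F -> spread u x @: J = u @: J.
Proof.
by move=> /subsetP JF; apply: eq_in_imset => l /JF lF; rewrite spread_bag.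
Qed.

Section Path.

Variables (G H : sgraph) (V : set_family G) (W : set_family H).
Variable R : {ffun 'I_k -> G} -> {ffun 'I_k -> H} -> Prop.
Hypothesis bisR : bisim w V W R.

(* The third free pebble walks one step ahead of the first one. *)
Lemma bisim_path (J : {set 'I_k}) (p : seq G) u v :
    J \subset F -> R u v -> u \in Vplus w k V ->
    path (avoid (u @: J)) (u free1) p -> last (u free1) p = u free2 ->
  v free2 \in cmp (v @: J) (v free1).
Proof.
move=> JF; elim: p u v => [|x p IHp] u v uv uV /=.
  move=> _ /eqP; have [_ /(_ uV)[iso _]] := bisR uv.
  by rewrite (iso_typeE _ _ iso).1 => /eqP->; apply: cmp_refl.
case/andP=> /and3P[u1 xJ u1x] pP last_p.
have [_ /(_ uV)[_ [f f_bij fR]]] := bisR uv.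
have uv3 := fR free3 x; set u3 := subst u free3 x in uv3; set v3 := subst v _ _ in uv3.
have u3V : u3 \in Vplus w k V by rewrite Vplus_subst_free ?free3N.
have u4V : subst u3 free1 (u3 free3) \in Vplus w k V by rewrite Vplus_subst_free ?free1N.
have uv4 := bisim_copy bisR uv3 u3V u4V.
have {IHp} := IHp _ _ uv4 u4V; rewrite !imset_subst_free ?free1N ?free3N // !substE !free_neq !eqxx.
move=> /(_ pP last_p) IHp.
have [_ /(_ u3V)[iso _]] := bisR uv3.
have := iso_type_mem J free1 iso; have := iso_type_mem J free3 iso.
have := (iso_typeE free1 free3 iso).2.
rewrite !imset_subst_free ?free3N // !substE !free_neq !eqxx u1x (negbTE u1) (negbTE xJ).
move=> /esym v1x /esym vxJ /esym v1J; apply: cmp_trans IHp.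
by apply: cmp_step v1x; rewrite ?cmp_refl ?v1J ?vxJ.
Qed.

End Path.

(** Allowing any set [J] of bag positions covers components of the whole graph ([J] empty) and of
    the graph minus part of a bag. *)
Lemma bisim_cmp (G H : sgraph) (V : set_family G) (W : set_family H) R
    (J : {set 'I_k}) u v :
    bisim w V W R -> J \subset F -> R u v -> u \in Vplus w k V ->
  (u free2 \in cmp (u @: J) (u free1)) = (v free2 \in cmp (v @: J) (v free1)).
Proof.
move=> bisR JF uv uV; have [eqV _] := bisR _ _ uv.
apply/idP/idP => [cu | cv].
  have /connectP[p pP /esym last_p] := etrans (esym (in_set _ _)) cu.
  exact: (bisim_path bisR JF uv uV pP last_p).
have /connectP[p pP /esym last_p] := etrans (esym (in_set _ _)) cv.
by apply: (bisim_path (bisim_sym bisR) JF uv _ pP last_p); rewrite -eqV.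
Qed.

(** A single bijection serves all purposes: with [free2] on [x], copying it to the other free
    pebbles gives [spread], and copying pebble [l] to [free1] tests reachability from [u l] to [x].
    Pebble [l] differs from [free2], which is overwritten. *)
Lemma game (G H : sgraph) (V : set_family G) (W : set_family H) R u v :
    bisim w V W R -> R u v -> u \in Vplus w k V ->
  exists2 f : G -> H, bijective f &
    [/\ forall j x, R (subst u j x) (subst v j (f x)),
        forall x, R (spread u x) (spread v (f x)),
        forall l x, l != free2 ->
          (u l == x) = (v l == f x) /\ edge (u l) x = edge (v l) (f x)
      & forall (J : {set 'I_k}) l x, J \subset F -> l != free2 ->
          (x \in cmp (u @: J) (u l)) = (f x \in cmp (v @: J) (v l))].
Proof.
move=> bisR uv uV; have [_ /(_ uV)[iso [f f_bij fR]]] := bisR u v uv.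
have u2V x : subst u free2 x \in Vplus w k V by rewrite Vplus_subst_free ?free2N.
have u3V x y : subst (subst u free2 x) free1 y \in Vplus w k V.
  by rewrite Vplus_subst_free ?free1N.
exists f => //; split=> // [x | l x lN2 | J l x JF lN2].
- have uv3 := bisim_copy (j := free1) (l := free2) bisR (fR free2 x) (u2V x) (u3V _ _).
  have := bisim_copy (j := free3) (l := free2) bisR uv3 (u3V _ _).
  rewrite Vplus_subst_free ?free3N // => /(_ (u3V _ _)).
  have spreadE (K : sgraph) (s : {ffun 'I_k -> K}) y :
    subst (subst (subst s free2 y) free1 (subst s free2 y free2)) free3
      (subst (subst s free2 y) free1 (subst s free2 y free2) free2) = spread s y.
    apply/ffunP=> l; rewrite !substE !free_neq !eqxx; case: (freeP l) => [lF|->|->|->].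
    - have lN f0 : f0 \notin F -> (l == f0) = false.
        by move=> f0N; apply: contraNF f0N => /eqP<-.
      by rewrite spread_bag // !lN ?free1N ?free2N ?free3N.
    - by rewrite ?free_neq ?eqxx spread_free ?free1N.
    - by rewrite ?free_neq ?eqxx spread_free ?free2N.
    - by rewrite ?free_neq ?eqxx spread_free ?free3N.
  by rewrite !spreadE.
- have [_ /(_ (u2V x))[iso2 _]] := bisR _ _ (fR free2 x).
  by have := iso_typeE l free2 iso2; rewrite !substE eqxx (negbTE lN2).
have uv3 := bisim_copy (j := free1) (l := l) bisR (fR free2 x) (u2V x) (u3V _ _).
have := bisim_cmp bisR JF uv3 (u3V _ _).
by rewrite !imset_subst_free ?free1N ?free2N // !substE !free_neq !eqxx (negbTE lN2).
Qed.

End Game.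

Arguments free1 {w}.
Arguments free2 {w}.
Arguments free3 {w}.

(** * Sliding the pebbles of a bag *)

Section Moves.

Variable w : nat.
Local Notation k := (w + 3).
Local Notation F := (bag_pos w k).

Lemma card_bag_pos : #|F| = w.
Proof.
have -> : F = [set lshift 3 i | i : 'I_w].
  apply/setP=> l; rewrite inE; apply/idP/imsetP => [lw | [i _ ->] /=]; last exact: ltn_ord.
  by exists (Ordinal lw); rewrite ?inE //; apply: val_inj.
by rewrite card_imset ?card_ord //; apply: lshift_inj.
Qed.

Lemma bag_pos_neq (l m : 'I_k) : l \in F -> m \notin F -> l != m.
Proof. by move=> lF; apply: contraNneq => <-. Qed.

Lemma iso_type_map (G H : sgraph) (u : {ffun 'I_k -> G}) (v : {ffun 'I_k -> H})
    (J : {set 'I_k}) :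
  iso_type u = iso_type v ->
  exists2 sigma : G -> H, iso_on (u @: J) sigma & forall l, sigma (u l) = v l.
Proof.
have k_gt0 : 0 < k by rewrite addn3.
move=> /(iso_typeP _ _ k_gt0)[sigma [su s_inj s_mono]]; exists sigma => //.
apply/iso_onP=> _ _ /imsetP[i _ ->] /imsetP[j _ ->].
by rewrite s_mono ?codom_f // (inj_in_eq s_inj) ?codom_f.
Qed.

Variables (G H : sgraph) (V : set_family G) (W : set_family H).
Variable R : {ffun 'I_k -> G} -> {ffun 'I_k -> H} -> Prop.
Hypothesis bisR : bisim w V W R.

Definition retuple (K : sgraph) (rho : 'I_k -> 'I_k) (s : {ffun 'I_k -> K}) :
  {ffun 'I_k -> K} := [ffun l => s (rho l)].

(** The pebbles of [Q] move onto pebble [l0] one after the other; each vertex they leave still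
    carries a bag pebble outside [Q], so all intermediate tuples occupy the same bag and stay in
    [Vplus]. *)
Lemma bisim_collapse (Q : {set 'I_k}) l0 u v :
    let rho l := if l \in Q then l0 else l in
    R u v -> u \in Vplus w k V -> l0 \in F -> l0 \notin Q ->
    {in Q, forall l, exists2 m, m \in F :\: Q & u m = u l} ->
  R (retuple rho u) (retuple rho v) /\ retuple rho u @: F = u @: F.
Proof.
have [n] := ubnP #|Q|; elim: n => // n IHn in Q *.
move=> leQ rho uv uV l0F l0Q repeated.
have im : retuple rho u @: F = u @: F.
  apply/setP=> x; apply/imsetP/imsetP=> -[l lF ->]; rewrite ?ffunE.
    by rewrite /rho; case: ifP => _; [exists l0 | exists l].
  case: (boolP (l \in Q)) => lQ.
    have [m] := repeated l lQ; rewrite inE => /andP[mQ mF] <-.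
    by exists m; rewrite // ffunE /rho (negbTE mQ).
  by exists l; rewrite // ffunE /rho (negbTE lQ).
split=> //; have [Q0|[q qQ]] := set_0Vmem Q.
  have id_rho (K : sgraph) (s : {ffun 'I_k -> K}) : retuple rho s = s.
    by apply/ffunP=> l; rewrite ffunE /rho Q0 inE.
  by rewrite !id_rho.
have [|||uv1 im1] := IHn (Q :\ q) _ uv uV l0F; rewrite ?inE ?(negbTE l0Q) ?andbF //.
- by move: leQ; rewrite (cardsD1 q Q) qQ.
- move=> l /setD1P[_ lQ]; have [m mFQ <-] := repeated l lQ; exists m => //.
  by move: mFQ; rewrite !inE => /andP[/negbTE-> ->]; rewrite andbF.
have substq (K : sgraph) (s : {ffun 'I_k -> K}) :
    let s1 := retuple (fun l => if l \in Q :\ q then l0 else l) s in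
    subst s1 q (s1 l0) = retuple rho s.
  apply/ffunP=> l; rewrite substE !ffunE !inE (negbTE l0Q) andbF /rho.
  by case: eqVneq => [->|]; rewrite ?qQ.
by have := bisim_copy (j := q) (l := l0) bisR uv1; rewrite /= !substq; apply;
  rewrite in_Vplus ?im1 ?im -in_Vplus.
Qed.

(** Intermediate bags must belong to the family, so the pebbles are first rearranged inside the old
    bag until one of them, [j], can be spared; moving [j] then gives [S1] at once. *)
Lemma bisim_move u v (S1 : {set G}) :
    R u v -> u \in Vplus w k V -> #|S1| <= w ->
    u @: F :&: S1 != set0 -> #|u @: F :\: S1| <= 1 -> #|S1 :\: u @: F| <= 1 ->
  exists rho : 'I_k -> 'I_k,
    [/\ {in F, forall l, rho l \in F}, forall l, l \notin F -> rho l = l,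
        R (retuple rho u) (retuple rho v), retuple rho u @: F = u @: F
      & exists2 j, j \in F & exists e, subst (retuple rho u) j e @: F = S1].
Proof.
move=> uv uV leS1 /set0Pn[s0 /setIP[/imsetP[l0 l0F ->] l0S1]] le1 le2.
have im_subst (s : {ffun 'I_k -> G}) j e : j \in F ->
    subst s j e @: F = e |: (s @: (F :\ j)).
  move=> jF; apply/setP=> x; rewrite !inE; apply/imsetP/orP=> [[l lF ->]|].
    rewrite substE; case: (eqVneq l j) => lj; [by left|right].
    by apply/imsetP; exists l; rewrite // in_setD1 lj.
  case=> [/eqP->|/imsetP[l /setD1P[lj lF] ->]]; first by exists j; rewrite // substE eqxx.
  by exists l; rewrite // substE (negbTE lj).
(* If a vertex [a] leaves the bag, all its bag pebbles but [j] are collapsed onto [l0], which lies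
   on a vertex shared with [S1]. *)
have [/eqP SS1|[a]] := set_0Vmem (u @: F :\: S1); last first.
  rewrite inE => /andP[aS1 /imsetP[j jF defa]].
  have onlya x : x \in u @: F -> x \notin S1 -> x = a.
    by move=> xS xS1; apply: (card_le1_eqP le1); rewrite inE ?xS1 ?aS1 // defa imset_f.
  pose Q := [set l in F | (u l == a) && (l != j)].
  pose rho l := if l \in Q then l0 else l.
  have al0 : u l0 != a by apply: contraNneq aS1 => <-.
  have l0Q : l0 \notin Q by rewrite !inE (negbTE al0) andbF.
  have [|uv1 im1] := bisim_collapse uv uV l0F l0Q.
    move=> l; rewrite inE => /and3P[lF /eqP-> lj]; exists j; rewrite // !inE eqxx !andbF.
    by move: jF; rewrite inE.
  exists rho; split=> //.
  - by move=> l lF; rewrite /rho; case: ifP.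
  - by move=> l lF; rewrite /rho inE (negbTE lF).
  exists j => //.
  (* [b] is the vertex entering the bag; if none enters, [j] is parked on the shared vertex
     [u l0]. *)
  pose b := if [pick x in S1 :\: u @: F] is Some x then x else u l0.
  have bS1 : b \in S1 by rewrite /b; case: pickP => [x /setDP[]|].
  exists b; rewrite im_subst //; apply/eqP; rewrite eqEsubset; apply/andP; split.
    apply/subsetP=> x /setU1P[->//|/imsetP[l /setD1P[lj lF] ->]].
    rewrite ffunE /rho; case: ifPn => // lQ; apply: contraNT lQ => ulS1.
    have ula : u l = a by apply: onlya; rewrite ?imset_f.
    by rewrite !inE ula eqxx lj; move: lF; rewrite inE => ->.
  apply/subsetP=> x xS1; have [xS|xS] := boolP (x \in u @: F); last first.
    have xD : x \in S1 :\: u @: F by rewrite inE xS.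
    rewrite !inE /b; case: pickP => [y yD|/(_ x)]; last by rewrite xD.
    by rewrite (card_le1_eqP le2 x y xD yD) eqxx.
  apply/setU1P; right; move: (xS); rewrite -im1 => /imsetP[m mF xm].
  apply/imsetP; exists m => //; rewrite !inE; move: (mF); rewrite inE => ->; rewrite andbT.
  apply: contraTneq xS1 => mj; rewrite xm mj ffunE /rho ifN -?defa //.
  by rewrite !inE eqxx !andbF.
have {}SS1 : u @: F \subset S1 by rewrite -setD_eq0.
have retuple_id (K : sgraph) (s : {ffun 'I_k -> K}) : retuple id s = s.
  by apply/ffunP=> l; rewrite ffunE.
exists id; rewrite !retuple_id; split=> //.
have [/eqP S1S|[b]] := set_0Vmem (S1 :\: u @: F).
  exists l0 => //; exists (u l0); have -> : S1 = u @: F.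
    by apply/eqP; rewrite eqEsubset SS1 -setD_eq0 S1S.
  by apply: eq_imset => l; rewrite substE; case: eqP => [->|].
rewrite inE => /andP[bS bS1].
have S1E : S1 = b |: u @: F.
  apply/setP=> x; rewrite !inE; apply/idP/orP=> [xS1|[/eqP->//|]]; last exact: (subsetP SS1).
  have [|xS] := boolP (x \in u @: F); [by right | left; apply/eqP].
  by apply: (card_le1_eqP le2); rewrite inE ?xS ?bS.
(* The old bag has fewer than [w] vertices, so two of the [w] bag pebbles share a vertex and one of
   them can be spared. *)
have /dinjectivePn[j jF [l /andP[/= lj lF] ujl]] : ~~ dinjectiveb u F.
  apply/dinjectiveP=> /card_in_imset cF; move: leS1.
  by rewrite S1E cardsU1 bS cF card_bag_pos add1n ltnn.
exists j => //; exists b; rewrite im_subst // S1E; congr (_ |: _).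
apply/setP=> x; apply/imsetP/imsetP=> [[m /setD1P[_ mF]]|[m mF ->]]; first by exists m.
case: (eqVneq m j) => [->|mj]; last by exists m; rewrite // in_setD1 mj.
by exists l; rewrite // in_setD1 lj.
Qed.

End Moves.

Lemma leq_card_inj (A B : finType) (P : {set A}) (Q : {set B}) (f : A -> B) :
  {in P &, injective f} -> {in P, forall x, f x \in Q} -> #|P| <= #|Q|.
Proof.
move=> f_inj fPQ; rewrite -(card_in_imset f_inj); apply/subset_leq_card/subsetP.
by move=> _ /imsetP[x xP ->]; apply: fPQ.
Qed.

Lemma eq_card_bij (A B : finType) (P : {set A}) (Q : {set B}) (f : A -> B) :
  bijective f -> (forall x, (x \in P) = (f x \in Q)) -> #|P| = #|Q|.
Proof.
move=> [g gK fK] fPQ; apply/eqP; rewrite eqn_leq (leq_card_inj (f := f)) /=.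
- by rewrite (leq_card_inj (f := g)) // => [x y _ _ /(can_inj fK)|y]; rewrite // fPQ fK.
- by move=> x y _ _ /(can_inj gK).
- by move=> x; rewrite fPQ.
Qed.

Lemma cmp_remove (G : sgraph) (J J' : {set G}) x e :
    (forall a d, a \in J -> d \in cmp J x -> edge a d -> a \in J') ->
    x \notin J -> e \in J' ->
  {in cmp J x :\ e, forall y, cmp J' y \subset cmp J x :\ e}.
Proof.
move=> JJ' xJ eJ' y yA; apply/subsetP; apply: cmp_ind => // {yA}y z.
rewrite !in_setD1 => /andP[_ yD] _ zJ' yz; apply/andP; split.
  by apply: contraNneq zJ' => ->.
apply: (cmp_step yD (cmp_notin xJ yD) _ yz); apply: contra zJ' => zJ.
by apply: JJ' zJ yD _; rewrite edge_sym.
Qed.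

(** * Branches of a tree decomposition *)

Section Decomposition.

Variables (G T : sgraph) (X : T -> {set G}).
Hypothesis decX : tree_decomposition X.

Lemma bags_connected (v : G) (s t j : T) :
  v \in X s -> v \in X t -> v \notin X j -> s \in cmp [set j] t.
Proof.
have [_ _ _ conn] := decX; move=> vs vt vj.
have := conn v t s; rewrite !inE => /(_ vt vs); apply: connect_sub => a b /=.
rewrite !inE => /and3P[va vb ab]; apply: connect1; rewrite /avoid !inE ab andbT.
by apply/andP; split; [apply: contraNneq vj => <- | apply: contraNneq vj => <-].
Qed.

Lemma branch_exists (i t : T) : t != i -> exists2 j, edge i j & t \in cmp [set i] j.
Proof.
move=> ti; have [[_ conn _] _ _ _] := decX.
have /connectP[p0 /shortenP[p pP p_uniq _] last_p] := conn i t (in_setT i) (in_setT t).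
case: p pP p_uniq last_p => [|j p] pP p_uniq last_p; first by rewrite last_p eqxx in ti.
move: pP => /= /andP[/and3P[_ _ ij] pP]; exists j => //; rewrite inE.
apply/connectP; exists p => //; have {p_uniq} ip : i \notin j :: p by case/andP: p_uniq.
apply: (sub_in_path (P := mem (j :: p))) pP; last exact/allP.
move=> a b ap bp /and3P[_ _ ab]; rewrite /avoid !inE ab andbT.
by apply/andP; split; [apply: contraNneq ip => <- | apply: contraNneq ip => <-].
Qed.

(** Along a walk avoiding [X i], consecutive vertices share a bag and the bags of each vertex form a
    subtree missing [i], so the branch at [i] never changes. *)
Lemma cmp_branch (i j t s : T) (c d : G) :
    c \notin X i -> c \in X t -> t \in cmp [set i] j ->
  d \in cmp (X i) c -> d \in X s -> s \in cmp [set i] j.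
Proof.
move=> ci ct tj dD; move: d dD s.
apply: (@cmp_ind _ _ _ (fun d => forall s, d \in X s -> s \in cmp [set i] j)).
  by move=> s cs; apply: cmp_trans tj _; apply: bags_connected cs ct ci.
move=> y z IHy yi zi yz s zs; have [_ _ edges _] := decX.
have [r /andP[yr zr]] := edges _ _ yz; apply: cmp_trans (IHy r yr) _.
exact: bags_connected zs zr zi.
Qed.

(** A bag containing the edge [ad] lies in the branch of [j], since it contains [d]; were [a]
    missing from [X j], the bags of [a] would link it to [i] around [j], against [tree_edge_cut]. *)
Lemma separator_shared (i j t : T) (a c d : G) :
    edge i j -> c \notin X i -> c \in X t -> t \in cmp [set i] j ->
  a \in X i -> d \in cmp (X i) c -> edge a d -> a \in X j.
Proof.
move=> ij ci ct tj ai dD ad; apply: contraLR isT => aj.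
have [tree _ edges _] := decX; have [r /andP[ar dr]] := edges _ _ ad.
case: (tree_edge_cut tree ij (cmp_branch ci ct tj dD dr)).
exact: bags_connected ar ai aj.
Qed.

(** The measure for the induction along the tree: the branch beyond [l] lies inside the branch at
    [j] and misses [j] itself. *)
Lemma branch_shrink (i j l t : T) :
    edge i j -> edge j l -> t \in cmp [set i] j -> t \in cmp [set j] l ->
  #|cmp [set j] l| < #|cmp [set i] j|.
Proof.
move=> ij jl tij tjl; have [tree _ _ _] := decX.
have ijl : i \notin cmp [set j] l.
  apply/negP=> il; apply: tree_edge_cut tree ij tij _.
  by rewrite (cmp_eq il).
have neq_ji : j != i by apply: contraTneq ij => ->; rewrite edge_irrefl.
have neq_lj : l != j by apply: contraTneq jl => ->; rewrite edge_irrefl.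
have ji y : y \in cmp [set j] l -> y != i by move=> yl; apply: contraNneq ijl => <-.
apply: proper_card; rewrite properE; apply/andP; split; last first.
  apply/subsetPn; exists j; first exact: cmp_refl.
  by apply/negP=> /(cmp_notin (J := [set j])); rewrite !inE eqxx neq_lj => /(_ isT).
apply/subsetP=> y yl; have [] // : y \in cmp [set j] l /\ y \in cmp [set i] j.
move: y yl; apply: cmp_ind => [|y z [yl yj] yJ zJ yz].
  split; first exact: cmp_refl.
  by apply: cmp_step (cmp_refl _ _) _ _ jl; rewrite inE // ji ?cmp_refl.
have zl : z \in cmp [set j] l by apply: cmp_step yz.
by split=> //; apply: cmp_step (yj) _ _ yz; rewrite inE ji.
Qed.

End Decomposition.

(** * Components touched by a bag *)

Section Extension.

Variable w : nat.
Local Notation k := (w + 3).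
Local Notation F := (bag_pos w k).
Variables (G H : sgraph) (V : set_family G) (W : set_family H) (r : nat).
Local Notation col := (@wl w k G V r).
Local Notation col' := (@wl w k H W r).
Hypothesis bisR : bisim w V W (fun u v => col u = col' v).

Lemma count_colors (u : {ffun 'I_k -> G}) (v : {ffun 'I_k -> H}) (P : {set G})
    (Q : {set H}) (f : G -> H) c : bijective f ->
    (forall x, col (spread u x) = col' (spread v (f x))) ->
    (forall x, (x \in P) = (f x \in Q)) ->
  #|[set x in P | col (spread u x) == c]| = #|[set y in Q | col' (spread v y) == c]|.
Proof.
by move=> f_bij fcol fPQ; apply: eq_card_bij f_bij _ => x; rewrite !inE fPQ fcol.
Qed.

(** The bijection answering at [spread u x] preserves both the component and the colors relative to
    the bag; this is the color balance that [glue] requires. *)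
Lemma component_colors (u : {ffun 'I_k -> G}) (v : {ffun 'I_k -> H}) x y c :
    u \in Vplus w k V -> col (spread u x) = col' (spread v y) ->
  #|[set z in cmp (u @: F) x | col (spread u z) == c]| =
  #|[set z in cmp (v @: F) y | col' (spread v z) == c]|.
Proof.
move=> uV xy; have xV : spread u x \in Vplus w k V by rewrite in_Vplus imset_spread -?in_Vplus.
have [f f_bij [_ fspr _ fcmp]] := game bisR xy xV.
have spread2 (K : sgraph) (q : {ffun 'I_k -> K}) a b : spread (spread q a) b = spread q b.
  by apply: eq_spread => m mF; rewrite spread_bag.
apply: count_colors f_bij _ _ => z; first by have := fspr z; rewrite !spread2.
have := fcmp F free1 z (subxx _); rewrite free_neq !spread_free ?free1N //.
by rewrite !imset_spread // => ->.
Qed.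

Hypothesis width_V : width_at_most w V.
Variables (T : sgraph) (X : T -> {set G}).
Hypotheses (decX : tree_decomposition X) (smX : semi_smooth X) (capX : captures V X).

(** Induction on the size of the branch at [j]. The attaching edge [sd] makes [X i] and [X j] share
    the vertex [s], as a slide requires. *)
Lemma extend_component n (i j t : T) (u : {ffun 'I_k -> G}) (v : {ffun 'I_k -> H}) :
    #|cmp [set i] j| < n -> edge i j -> t \in cmp [set i] j ->
    col u = col' v -> u @: F = X i -> u free1 \notin X i -> u free1 \in X t ->
    (exists s d, [/\ s \in X i, d \in cmp (X i) (u free1) & edge s d]) ->
  exists phi : G -> H,
    [/\ iso_on (X i :|: cmp (X i) (u free1)) phi,
        {in F, forall l, phi (u l) = v l}
      & {in cmp (X i) (u free1), forall y, phi y \in cmp (v @: F) (v free1)}].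
Proof.
elim: n => // n IHn in i j t u v *.
move=> leij ij tij uv uX ci ct [s [d [si dD sd]]].
have shared a y := separator_shared decX ij ci ct tij (a := a) (d := y).
have uV : u \in Vplus w k V by rewrite in_Vplus uX.
have := smX ij; rewrite -subn1 leq_subLR geq_max => /andP[lei lej].
have [||||rho [rhoF rho_id uv1 im1 [j0 j0F [e im2]]]] :=
  bisim_move bisR (S1 := X j) uv uV; first exact/width_V.
- by rewrite uX; apply/set0Pn; exists s; rewrite inE si (shared s d).
- by rewrite uX cardsD leq_subLR addnC.
- by rewrite uX cardsD leq_subLR addnC [X j :&: _]setIC.
have iso0 : iso_type u = iso_type v by have [_ /(_ uV)[]] := bisR uv.
set u1 := retuple rho u in uv1 im1 im2; set v1 := retuple rho v in uv1.
have imv1 : v1 @: F = v @: F.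
  apply/setP=> y; apply/imsetP/imsetP=> -[l lF ->].
    by rewrite ffunE; exists (rho l); rewrite ?rhoF.
  have /imsetP[m mF /eqP] : u l \in u1 @: F by rewrite im1 imset_f.
  rewrite ffunE (iso_typeE _ _ iso0).1 => /eqP vl; exists m => //.
  by rewrite ffunE.
have u1c : u1 free1 = u free1 by rewrite ffunE rho_id ?free1N.
have v1c : v1 free1 = v free1 by rewrite ffunE rho_id ?free1N.
rewrite uX in im1.
have u1V : u1 \in Vplus w k V by rewrite in_Vplus im1.
have iso1 : iso_type u1 = iso_type v1 by have [_ /(_ u1V)[]] := bisR uv1.
have [f f_bij [fR _ fpt fcmp]] := game bisR uv1 u1V.
set c := u free1 in ci ct dD shared u1c *; set c' := v free1 in v1c *.
have FN2 l : l \in F -> l != free2 by move=> lF; rewrite bag_pos_neq ?free2N.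
set u2 := subst u1 j0 e in im2; pose v2 := subst v1 j0 (f e).
have uv2 : col u2 = col' v2 by apply: fR.
have u2V : u2 \in Vplus w k V by rewrite in_Vplus im2.
have iso2 : iso_type u2 = iso_type v2 by have [_ /(_ u2V)[]] := bisR uv2.
have u2j : u2 j0 = e by rewrite substE eqxx.
have v2j : v2 j0 = f e by rewrite substE eqxx.
have u2E l : l != j0 -> u2 l = u1 l by move=> lj; rewrite substE (negbTE lj).
have v2E l : l != j0 -> v2 l = v1 l by move=> lj; rewrite substE (negbTE lj).
clearbody u2 v2.
have free1j0 : free1 != j0 by rewrite eq_sym bag_pos_neq ?free1N.
have u2c : u2 free1 = c by rewrite u2E.
have v2c : v2 free1 = c' by rewrite v2E.
(* Since [f] preserves equality with each bag pebble, the old and the new bag overlap in the same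
   pattern in both graphs. *)
have agree l m : l \in F -> (u1 l == u2 m) = (v1 l == v2 m).
  move=> lF; have [->|mj] := eqVneq m j0; first by rewrite u2j v2j (fpt l e (FN2 l lF)).1.
  by rewrite u2E // v2E // (iso_typeE _ _ iso1).1.
have agreeX l : l \in F -> (u1 l \in X j) = (v1 l \in v2 @: F).
  move=> lF; rewrite -im2; apply/imsetP/imsetP=> -[m mF /eqP].
    by rewrite agree // => /eqP; exists m.
  by rewrite -agree // => /eqP; exists m.
rewrite -imv1; set S' := v1 @: F.
have c'S' : c' \notin S' by rewrite -v1c -(iso_type_mem _ _ iso1) im1 u1c.
have fD y : (y \in cmp (X i) c) = (f y \in cmp S' c').
  by have := fcmp F free1 y (subxx _); rewrite !free_neq im1 u1c v1c => ->.
have fsurj y : exists x, y = f x by have [g _ fK] := f_bij; exists (g y).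
have shared' a y : a \in S' -> y \in cmp S' c' -> edge a y -> a \in v2 @: F.
  move=> /imsetP[l lF ->]; have [x ->] := fsurj y; rewrite -fD => xD.
  rewrite -(fpt l x (FN2 l lF)).2 -agreeX // => lx; apply: shared xD lx.
  by rewrite -im1 imset_f.
have onlye y : y \in cmp (X i) c -> y \in X j -> y = e.
  move=> yD; rewrite -im2 => /imsetP[m mF ym].
  have [mj|mj] := eqVneq m j0; first by rewrite ym mj.
  by have := cmp_notin ci yD; rewrite ym u2E // -im1 imset_f.
have onlye' y : y \in cmp S' c' -> y \in v2 @: F -> y = f e.
  move=> yD /imsetP[m mF ym].
  have [mj|mj] := eqVneq m j0; first by rewrite ym mj.
  by have := cmp_notin c'S' yD; rewrite ym v2E // imset_f.
(* It suffices to extend from the new bag: vertices of [X i] outside [X j] have no neighbour in the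
   component and are attached afterwards through the isomorphism type of the old bag. *)
suff [phi [phi_iso phi_u2 phiD]] : exists phi : G -> H,
    [/\ iso_on (X j :|: cmp (X i) c) phi, {in F, forall l, phi (u2 l) = v2 l}
      & {in cmp (X i) c, forall y, phi y \in cmp S' c'}].
  have [sigma sigma_iso sigma_u1] := iso_type_map F iso1; rewrite im1 in sigma_iso.
  pose Q := (X i :&: X j) :|: cmp (X i) c.
  exists (piecewise (X i) sigma phi).
  have -> : X i :|: cmp (X i) c = X i :|: Q.
    by apply/setP=> y; rewrite !(in_setU, in_setI); case: (y \in X i).
  split.
  - apply: piecewise_iso => //.
    + by apply: iso_onS phi_iso; rewrite setSU // subsetIr.
    + move=> y; rewrite in_setI in_setU in_setI => /andP[yi].
      have /imsetP[l lF yl] : y \in u1 @: F by rewrite im1.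
      case/orP=> [/andP[_ yj]|/(cmp_notin ci)]; last by rewrite yi.
      move: yj; rewrite -im2 => /imsetP[m mF ym].
      by rewrite {2}ym phi_u2 // yl sigma_u1; apply/eqP; rewrite -agree // -yl ym.
    move=> x y; rewrite !(in_setD, in_setU, in_setI) => /andP[xQ xi] /andP[yi].
    rewrite (negbTE yi) /= => yD; have /imsetP[l lF xl] : x \in u1 @: F by rewrite im1.
    have xj : x \notin X j by apply: contra xQ => ->; rewrite xi.
    split.
    + by apply: contra xj => xy; apply: shared xi yD xy.
    + rewrite xl sigma_u1; apply/eqP=> vl; have := cmp_notin c'S' (phiD y yD).
      by rewrite -vl imset_f.
    apply: contra xj; rewrite xl sigma_u1 agreeX // => ly.
    by apply: shared' (phiD y yD) ly; rewrite imset_f.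
  - move=> l lF; rewrite /piecewise -uX imset_f //.
    have /imsetP[m mF ulm] : u l \in u1 @: F by rewrite im1 -uX imset_f.
    rewrite ulm sigma_u1 ffunE; apply/esym/eqP; rewrite -(iso_typeE _ _ iso0).1.
    by rewrite ulm ffunE.
  - by move=> y yD; rewrite /piecewise (negbTE (cmp_notin ci yD)); apply: phiD.
have [_ bag _ _] := decX.
(* If [e] is outside the component, the component is also one of [G - X j] and the next tree edge
   applies; otherwise what remains after removing [e] is treated piece by piece. *)
have [eD|eD] := boolP (e \in cmp (X i) c); last first.
  have disj y : y \in cmp (X i) c -> y \notin X j.
    by move=> yD; apply: contra eD => yj; rewrite -(onlye y).
  have disj' y : y \in cmp S' c' -> y \notin v2 @: F.
    by move=> yD; apply: contra eD => yj; rewrite fD -(onlye' y).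
  have Dj := cmp_change shared disj ci; have Dj' := cmp_change shared' disj' c'S'.
  have cj : c \notin X j by apply: disj; apply: cmp_refl.
  have tj : t != j by apply: contraNneq cj => <-.
  have [l jl tl] := branch_exists decX tj.
  have lejl : #|cmp [set j] l| < n.
    by apply: leq_trans (branch_shrink decX ij jl tij tl) _; rewrite -ltnS.
  have := IHn j l t u2 v2 lejl jl tl uv2 im2; rewrite u2c v2c Dj Dj'; apply=> //.
  by exists s, d; rewrite (shared s d).
have ei : e \notin X i := cmp_notin ci eD.
have ej : e \in X j by rewrite -im2 -u2j imset_f.
have ej' : f e \in v2 @: F by rewrite -v2j imset_f.
have eD' : f e \in cmp S' c' by rewrite -fD.
have ei' : f e \notin S' := cmp_notin c'S' eD'.
(* The pebbles of [J], without [j0], still separate the component, now described as the component of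
   [e]. Hence the bijection [f1] below preserves it. *)
pose J := F :\ j0; have JF : J \subset F by apply: subsetDl.
have u2J : u2 @: J = u1 @: J by apply: eq_in_imset => l /setD1P[lj _]; rewrite u2E.
have v2J : v2 @: J = v1 @: J by apply: eq_in_imset => l /setD1P[lj _]; rewrite v2E.
have cmpJ : cmp (u2 @: J) e = cmp (X i) c.
  rewrite u2J -(cmp_eq eD); apply: cmp_change => //; rewrite (cmp_eq eD).
    move=> a y ai yD ay; have := shared a y ai yD ay; rewrite -im2 => /imsetP[m mF am].
    have [mj|mj] := eqVneq m j0; first by rewrite am mj u2j (negbTE ei) in ai.
    by rewrite am u2E // imset_f // in_setD1 mj.
  move=> y yD; apply: contra (cmp_notin ci yD); rewrite -im1.
  exact/subsetP/imsetS.
have cmpJ' : cmp (v2 @: J) (f e) = cmp S' c'.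
  rewrite v2J -(cmp_eq eD'); apply: cmp_change => //; rewrite (cmp_eq eD').
    move=> a y ai yD ay; have := shared' a y ai yD ay => /imsetP[m mF am].
    have [mj|mj] := eqVneq m j0; first by rewrite am mj v2j (negbTE ei') in ai.
    by rewrite am v2E // imset_f // in_setD1 mj.
  by move=> y yD; apply: contra (cmp_notin c'S' yD); apply/subsetP/imsetS.
have [sigma sigma_iso sigma_u2] := iso_type_map F iso2; rewrite im2 in sigma_iso.
have u3V x : subst u2 free1 x \in Vplus w k V by rewrite Vplus_subst_free ?free1N.
have uv3 := bisim_copy (j := free1) (l := j0) bisR uv2 u2V (u3V _).
have [f1 f1_bij [_ f1spr f1pt f1cmp]] := game bisR uv3 (u3V _).
have f1e x : (e == x) = (f e == f1 x).
  by have := f1pt free1 x; rewrite free_neq => /(_ isT)[]; rewrite !substE !eqxx u2j v2j.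
have f1D x : (x \in cmp (X i) c) = (f1 x \in cmp S' c').
  have := f1cmp J free1 x JF; rewrite free_neq => /(_ isT).
  by rewrite !imset_subst_free ?free1N // !substE !eqxx u2j v2j cmpJ cmpJ'.
have spread_subst (K : sgraph) (q : {ffun 'I_k -> K}) x y :
    spread (subst q free1 x) y = spread q y.
  by apply: eq_spread => l lF; rewrite substE ifN // bag_pos_neq ?free1N.
have f1A x : (x \in cmp (X i) c :\ e) = (f1 x \in cmp S' c' :\ f e).
  by rewrite !in_setD1 f1D eq_sym f1e eq_sym.
have f1col x : col (spread u2 x) = col' (spread v2 (f1 x)).
  by have := f1spr x; rewrite !spread_subst.
have [|||||x x'|phi [phi_iso phi_s phiA]] :=
  glue (S := X j) (S' := v2 @: F) (chi := fun x => col (spread u2 x))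
    (chi' := fun y => col' (spread v2 y)) (A := cmp (X i) c :\ e)
    (A' := cmp S' c' :\ f e) sigma_iso.
- rewrite disjoint_subset; apply/subsetP=> y /setD1P[ye yD].
  by rewrite inE; apply: contra ye => yj; rewrite (onlye y).
- rewrite disjoint_subset; apply/subsetP=> y /setD1P[ye yD].
  by rewrite inE; apply: contra ye => yj; rewrite (onlye' y).
- exact: cmp_remove.
- exact: cmp_remove.
- move=> x xA; exists x; first exact: cmp_refl.
  by rewrite (count_colors _ f1_bij f1col f1A).
- move=> xA x'A xx'; have [xe xD] := setD1P xA; have [xe' xD'] := setD1P x'A.
  have xj : x \notin X j by apply: contra xe => xj; rewrite (onlye x).
  have [t' xt'] := bag x.
  have tj : t' != j by apply: contraNneq xj => <-.
  have [l jl tl] := branch_exists decX tj.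
  have lejl : #|cmp [set j] l| < n.
    have tij' := cmp_branch decX ci ct tij xD xt'.
    by apply: leq_trans (branch_shrink decX ij jl tij' tl) _; rewrite -ltnS.
  (* A walk from [x] to [e] inside the component must enter [X j], which gives each piece an
     attaching edge. *)
  have [s' [d' [s'j _ d'x s'd']]] : exists s' d',
      [/\ s' \in X j, s' \in cmp (X i) x, d' \in cmp (X j) x & edge s' d'].
    by apply: (cmp_adjacent (e := e)); rewrite ?(cmp_notin ci xD) ?(cmp_eq xD).
  have imx : spread u2 x @: F = X j by rewrite imset_spread.
  have := IHn j l t' _ _ lejl jl tl xx' imx; rewrite !spread_free ?free1N //.
  rewrite imset_spread // => -[//|//||phi [phi_iso phi_u phiE]].
    by exists s', d'.
  exists phi; split=> //.
    move=> y; rewrite -im2 => /imsetP[m mF ->].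
    by rewrite sigma_u2 -(spread_bag u2 x mF) phi_u // spread_bag.
  by move=> c0; rewrite -im2; apply: component_colors.
exists phi; split.
- apply: iso_onS phi_iso; apply/subsetP=> y; rewrite !in_setU in_setD1.
  by case: eqVneq => [->|]; rewrite ?ej.
- by move=> l lF; rewrite phi_s ?sigma_u2 // -im2 imset_f.
- move=> y yD; have [->|ye] := eqVneq y e; first by rewrite phi_s // -{1}u2j sigma_u2 v2j.
  by have := phiA y; rewrite !in_setD1 ye yD => /(_ isT)/andP[].
Qed.

End Extension.

Lemma eq_card_image (A B : finType) (P : {set A}) (Q : {set B}) (f : A -> B)
    (a : pred A) (a' : pred B) :
    {in P &, injective f} -> f @: P = Q -> {in P, forall x, a x = a' (f x)} ->
  #|[set x in P | a x]| = #|[set y in Q | a' y]|.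
Proof.
move=> f_inj <- aa'; rewrite -(card_in_imset (f := f)); last first.
  by move=> x y; rewrite !inE => /andP[xP _] /andP[yP _]; apply: f_inj.
apply: eq_card => y; apply/imsetP/idP => [[x] | ].
  by rewrite !inE => /andP[xP ax] ->; rewrite imset_f //= -aa'.
rewrite inE => /andP[/imsetP[x xP ->] ax]; exists x => //.
by rewrite inE xP aa'.
Qed.

(** * Counting isomorphic components *)

Section ComponentIso.

(** Isomorphism of connected components as graphs rooted at [x] and [y]; [cmp set0] is a component
    of the graph itself. *)
Definition approx (G H : sgraph) (x : G) (y : H) : bool :=
  [exists phi : {ffun G -> H},
    [&& iso_on (cmp set0 x) phi, phi @: cmp set0 x == cmp set0 y & phi x == y]].

Lemma approxP (G H : sgraph) (x : G) (y : H) :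
  reflect (exists phi : G -> H,
             [/\ iso_on (cmp set0 x) phi, phi @: cmp set0 x = cmp set0 y & phi x = y])
          (approx x y).
Proof.
apply: (iffP existsP) => [[phi /and3P[iso /eqP im /eqP xy]]|[phi [iso im xy]]].
  by exists phi.
exists (finfun phi); rewrite ffunE xy eqxx andbT; apply/andP; split.
  by apply: eq_iso_on iso => z _; rewrite ffunE.
by rewrite -im; apply/eqP/eq_imset => z; rewrite ffunE.
Qed.

Lemma approx_map (G H : sgraph) (x z : G) (phi : G -> H) :
  iso_on (cmp set0 x) phi -> phi @: cmp set0 x = cmp set0 (phi x) ->
  z \in cmp set0 x -> approx z (phi z).
Proof.
move=> iso im zx; apply/approxP; exists phi; rewrite (cmp_eq zx) im.
by split=> //; rewrite (@cmp_eq _ _ (phi x)) // -im imset_f.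
Qed.

Lemma approx_refl (G : sgraph) (x : G) : approx x x.
Proof. by apply/approxP; exists id; rewrite iso_on_id imset_id. Qed.

Lemma approx_trans (G H K : sgraph) (x : G) (y : H) (z : K) :
  approx x y -> approx y z -> approx x z.
Proof.
move=> /approxP[phi [iso1 im1 xy]] /approxP[psi [iso2 im2 yz]].
apply/approxP; exists (psi \o phi); rewrite imset_comp im1 im2 /= xy yz; split=> //.
apply/iso_onP=> a b ax bx; have [e1 e2] := iso_onP _ _ iso1 a b ax bx.
have inH c : c \in cmp set0 x -> phi c \in cmp set0 y by move=> cx; rewrite -im1 imset_f.
by have [f1 f2] := iso_onP _ _ iso2 _ _ (inH a ax) (inH b bx); rewrite f1 f2 e1 e2.
Qed.

Lemma approx_sym (G H : sgraph) (x : G) (y : H) : approx x y -> approx y x.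
Proof.
move=> /approxP[phi [iso im xy]].
pose psi b := odflt x [pick a in cmp set0 x | phi a == b].
have phiK a : a \in cmp set0 x -> psi (phi a) = a.
  move=> ax; rewrite /psi; case: pickP => /= [c /andP[cx /eqP]|/(_ a)].
    exact: (iso_on_inj iso cx ax).
  by rewrite ax eqxx.
apply/approxP; exists psi; split; last by rewrite -xy phiK ?cmp_refl.
  apply/iso_onP=> b1 b2; rewrite -im => /imsetP[a1 a1x ->] /imsetP[a2 a2x ->].
  by rewrite !phiK //; have [-> ->] := iso_onP _ _ iso a1 a2 a1x a2x.
rewrite -im -imset_comp; rewrite -[RHS]imset_id; apply: eq_in_imset => a ax /=.
by rewrite phiK.
Qed.

Lemma approx_eqr (G H K : sgraph) (z : G) (x : H) (y : K) :
  approx x y -> approx z x = approx z y.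
Proof.
move=> xy; apply/idP/idP => zx; first exact: approx_trans zx xy.
exact: approx_trans zx (approx_sym xy).
Qed.

Lemma cmp0_edge (G : sgraph) (x y z : G) :
  y \in cmp set0 x -> edge y z -> z \in cmp set0 x.
Proof. by move=> yx yz; apply: (cmp_step yx _ _ yz); rewrite in_set0. Qed.

Lemma iso_on_setT (G H : sgraph) (f : G -> H) : #|G| = #|H| -> iso_on setT f -> is_iso f.
Proof.
move=> eqGH f_iso; split; last by move=> x y; rewrite (iso_onP _ _ f_iso x y _ _).2 ?in_setT.
by apply: inj_card_bij; rewrite ?eqGH // => x y; apply: (iso_on_inj f_iso); apply: in_setT.
Qed.

(* Exchange the components of [b] and [y] and fix everything else. *)
Lemma approx_automorphism (G : sgraph) (b y : G) : approx b y ->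
  exists alpha : G -> G, [/\ is_iso alpha, alpha b = y
    & forall z, z \notin cmp set0 b -> z \notin cmp set0 y -> alpha z = z].
Proof.
move=> by_; have /approxP[phi [isoP imP phib]] := by_.
have /approxP[psi [isoQ imQ _]] := approx_sym by_.
pose beta := piecewise (cmp set0 y) psi id.
have beta_iso : iso_on (cmp set0 y :|: ~: (cmp set0 b :|: cmp set0 y)) beta.
  apply: piecewise_iso => //; first exact: iso_on_id.
    by move=> z; rewrite !(in_setI, in_setC, in_setU) => /andP[->]; rewrite orbT.
  move=> x z; rewrite !(in_setD, in_setC, in_setU) => /andP[_ xy] /andP[_].
  rewrite negb_or => /andP[zb zy]; have xb : psi x \in cmp set0 b by rewrite -imQ imset_f.
  split; first by apply: contra zy; apply: cmp0_edge.
    by apply: contraNneq zb => <-.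
  by apply: contra zb; apply: cmp0_edge.
have betaN z : z \notin cmp set0 b -> beta z \notin cmp set0 y.
  move=> zb; rewrite /beta /piecewise; case: ifPn => // zy.
  have pb : psi z \in cmp set0 b by rewrite -imQ imset_f.
  by apply: contra zb => py; rewrite -(cmp_eq pb) (cmp_eq py).
(* If [y] lies in the component of [b], nothing is exchanged: [phi] is already an automorphism of
   that component. *)
exists (piecewise (cmp set0 b) phi (if y \in cmp set0 b then id else beta)).
split.
- apply: iso_on_setT => //; rewrite -(setUCr (cmp set0 b)); apply: piecewise_iso => //.
  + case: ifP => yb; first exact: iso_on_id.
    apply: iso_onS beta_iso; apply/subsetP=> z.
    by rewrite !(in_setU, in_setC) negb_or => ->; case: (z \in _).
  + by move=> z; rewrite in_setI in_setC andbN.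
  move=> x z; rewrite !(in_setD, in_setC) => /andP[_ xb] /andP[_ zb].
  have phix : phi x \in cmp set0 y by rewrite -imP imset_f.
  have zN : (if y \in cmp set0 b then id else beta) z \notin cmp set0 y.
    by case: ifP => [/cmp_eq-> //|_]; apply: betaN.
  split; first by apply: contra zb; apply: cmp0_edge.
    by apply: contraNneq zN => <-.
  by apply: contra zN; apply: cmp0_edge.
- by rewrite /piecewise cmp_refl.
- move=> z zb zy; rewrite /piecewise (negbTE zb); case: ifP => // _.
  by rewrite /beta /piecewise (negbTE zy).
Qed.

End ComponentIso.

(** * Components met by a bag, and the count of all others *)

Section Touched.

Variable w : nat.
Local Notation k := (w + 3).
Local Notation F := (bag_pos w k).

Definition touched (G : sgraph) (u : {ffun 'I_k -> G}) : {set G} :=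
  \bigcup_(l in F) cmp set0 (u l).

Lemma touchedP (G : sgraph) (u : {ffun 'I_k -> G}) x :
  reflect (exists2 l, l \in F & x \in cmp set0 (u l)) (x \in touched u).
Proof. exact: bigcupP. Qed.

Lemma touched_closed (G : sgraph) (u : {ffun 'I_k -> G}) x :
  x \in touched u -> cmp set0 x \subset touched u.
Proof.
move=> /touchedP[l lF xl]; apply/subsetP=> y yx; apply/touchedP; exists l => //.
exact: cmp_trans yx.
Qed.

Lemma bag_touched (G : sgraph) (u : {ffun 'I_k -> G}) : u @: F \subset touched u.
Proof.
apply/subsetP=> _ /imsetP[l lF ->]; apply/touchedP; exists l => //; exact: cmp_refl.
Qed.

Lemma tuple_of_bag (G : sgraph) (S : {set G}) (b : G) : b \in S -> #|S| <= w ->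
  exists (u : {ffun 'I_k -> G}) j,
    [/\ j \in F, u j = b, u @: F = S
      & forall l, l != j -> S :\ b != set0 -> u l \in S :\ b].
Proof.
move=> bS leS; have w_gt0 : 0 < w by apply: leq_trans leS; apply/card_gt0P; exists b.
have jk : w.-1 < k by apply: (leq_trans (n := w)); rewrite ?ltn_predL ?leq_addr.
(* [j] is the last bag position; positions beyond the list [s] take the default [d], which differs
   from [b] whenever [S] has another vertex. *)
pose j : 'I_k := Ordinal jk; pose s := enum (S :\ b); pose d := head b s.
have sE : size s = #|S|.-1 by rewrite -cardE (cardsD1 b S) bS.
have dS : d \in S.
  rewrite /d; case es: s => [|x s'] //=; have : x \in S :\ b.
    by rewrite -mem_enum -/s es mem_head.
  by case/setD1P.
have dSb : S :\ b != set0 -> d \in S :\ b.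
  move=> /set0Pn[x]; rewrite -mem_enum -/s /d => xs.
  by rewrite -mem_enum -/s; case: (s) xs => //= a s' _; apply: mem_head.
pose u : {ffun 'I_k -> G} := [ffun l => if l == j then b else nth d s l].
have jF : j \in F by rewrite inE /= ltn_predL.
have uN l : l != j -> S :\ b != set0 -> u l \in S :\ b.
  move=> lj /dSb dSb'; rewrite ffunE (negbTE lj).
  by case: (ltnP l (size s)) => ls; [rewrite -mem_enum mem_nth | rewrite nth_default].
exists u, j; split=> //; first by rewrite ffunE eqxx.
apply/setP=> x; apply/imsetP/idP => [[l _ ->] | xS].
  rewrite ffunE; case: ifP => // _; case: (ltnP l (size s)) => ls; last by rewrite nth_default.
  by have := mem_nth d ls; rewrite mem_enum => /setD1P[].
have [->|xb] := eqVneq x b; first by exists j; rewrite // ffunE eqxx.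
have xs : x \in s by rewrite mem_enum in_setD1 xb.
have lt_i : index x s < w.-1.
  by apply: leq_trans (_ : size s <= _); rewrite ?index_mem // sE -!subn1 leq_sub2r.
have ik : index x s < k by exact: ltn_trans lt_i jk.
exists (Ordinal ik); first by rewrite inE /= (leq_trans lt_i) ?leq_pred.
by rewrite ffunE ifN ?nth_index // -val_eqE /= neq_ltn lt_i.
Qed.

Variables (G H : sgraph) (V : set_family G) (W : set_family H) (r : nat).
Local Notation col := (@wl w k G V r).
Local Notation col' := (@wl w k H W r).
Hypothesis bisR : bisim w V W (fun u v => col u = col' v).
Hypothesis width_V : width_at_most w V.
Variables (T : sgraph) (X : T -> {set G}).
Hypotheses (decX : tree_decomposition X) (smX : semi_smooth X) (capX : captures V X).

(** Each component of [G] minus the bag inside [touched u] has an edge to the bag, so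
    [extend_component] applies and [glue] assembles the results. Components are mapped onto
    components because the bijection [f] gives them equal sizes. *)
Lemma touched_iso i (u : {ffun 'I_k -> G}) (v : {ffun 'I_k -> H}) :
    col u = col' v -> u @: F = X i ->
  exists phi : G -> H,
    [/\ iso_on (touched u) phi, {in F, forall l, phi (u l) = v l}
      & {in F, forall l, phi @: cmp set0 (u l) = cmp set0 (v l)}].
Proof.
move=> uv uX; have uV : u \in Vplus w k V by rewrite in_Vplus uX.
have [f f_bij [_ fspr fpt fcmp]] := game bisR uv uV.
have FN2 l : l \in F -> l != free2 by move=> lF; rewrite bag_pos_neq ?free2N.
have f0 l x : l \in F -> (x \in cmp set0 (u l)) = (f x \in cmp set0 (v l)).
  by move=> lF; have := fcmp set0 l x (sub0set _) (FN2 l lF); rewrite !imset0.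
have iso : iso_type u = iso_type v by have [_ /(_ uV)[]] := bisR uv.
have [sigma sigma_iso sigma_u] := iso_type_map F iso.
have fA x : (x \in touched u :\: u @: F) = (f x \in touched v :\: v @: F).
  rewrite !in_setD; congr (~~ _ && _).
    apply/imsetP/imsetP => -[l lF /eqP].
      by rewrite eq_sym (fpt l x (FN2 l lF)).1 eq_sym => /eqP; exists l.
    by rewrite eq_sym -(fpt l x (FN2 l lF)).1 eq_sym => /eqP; exists l.
  by apply/touchedP/touchedP => -[l lF xl]; exists l => //; rewrite ?f0 // -?f0.
have closedA (K : sgraph) (q : {ffun 'I_k -> K}) :
    {in touched q :\: q @: F, forall x, cmp (q @: F) x \subset touched q :\: q @: F}.
  move=> x; rewrite in_setD => /andP[xN xq]; apply/subsetP=> y yx.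
  rewrite in_setD (cmp_notin xN yx); apply: (subsetP (touched_closed xq)).
  exact: subsetP (cmp_sub x (sub0set _)) y yx.
have disjA (K : sgraph) (q : {ffun 'I_k -> K}) : [disjoint touched q :\: q @: F & q @: F].
  by rewrite disjoint_subset; apply/subsetP=> y; rewrite in_setD inE => /andP[].
have [|x x' xA xA' xx'|phi [phi_iso phi_s _]] :=
  glue (chi := fun x => col (spread u x)) (chi' := fun y => col' (spread v y))
    sigma_iso (disjA G u) (disjA H v) (closedA G u) (closedA H v).
- move=> x xA; exists x; first exact: cmp_refl.
  by rewrite (count_colors _ f_bij fspr fA).
- have [/touchedP[l lF xl] xN] := setDP xA; rewrite uX in xN.
  have [_ bag _ _] := decX; have [t xt] := bag x.
  have ti : t != i by apply: contraNneq xN => <-.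
  have [j ij tj] := branch_exists decX ti.
  have [s [d [si _ dx sd]]] : exists s d,
      [/\ s \in X i, s \in cmp set0 x, d \in cmp (X i) x & edge s d].
    apply: cmp_adjacent (_ : x \notin set0) xN (_ : u l \in X i) _; first by rewrite in_set0.
      by rewrite -uX imset_f.
    by rewrite cmp_sym.
  have imx : spread u x @: F = X i by rewrite imset_spread.
  have := extend_component bisR width_V decX smX capX (ltnSn _) ij tj xx' imx.
  rewrite !spread_free ?free1N // imset_spread // => -[//|//||phi [phi_iso phi_u phiE]].
    by exists s, d.
  exists phi; rewrite uX; split=> //.
    move=> y; rewrite -uX => /imsetP[m mF ->].
    by rewrite sigma_u -(spread_bag u x mF) phi_u // spread_bag.
  by move=> c; rewrite -uX; apply: component_colors.
have {}phi_iso : iso_on (touched u) phi.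
  by apply: iso_onS phi_iso; apply/subsetP=> y; rewrite in_setU in_setD => ->; case: (y \in _).
have phi_u l : l \in F -> phi (u l) = v l by move=> lF; rewrite phi_s ?sigma_u ?imset_f.
exists phi; split=> // l lF.
have sub : cmp set0 (u l) \subset touched u.
  by apply: touched_closed; apply: (subsetP (bag_touched u)); apply: imset_f.
apply/eqP; rewrite eqEcard; apply/andP; split.
  apply/subsetP=> _ /imsetP[y yl ->].
  have [] // : y \in cmp set0 (u l) /\ phi y \in cmp set0 (v l).
  move: y yl; apply: cmp_ind => [|y z [yl py] _ _ yz].
    by rewrite phi_u // !cmp_refl.
  have zl := cmp0_edge yl yz; split=> //; apply: cmp0_edge py _.
  by rewrite (iso_onP _ _ phi_iso y z _ _).2 // (subsetP sub).
rewrite card_in_imset; first by rewrite (eq_card_bij f_bij (f0 l ^~ lF)).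
by move=> x y xl yl; apply: (iso_on_inj phi_iso); apply: (subsetP sub).
Qed.

Hypothesis autV : forall f : G -> G, is_iso f -> V = [set f @: S | S : {set G} in V].
Variable mate : {ffun 'I_k -> G} -> {ffun 'I_k -> H}.
Hypotheses (mate_bij : bijective mate) (mateE : forall u, col u = col' (mate u)).

(* If a component [K] has a single vertex [b] in some bag, then moving the pebble on
   [b] around, while the other pebbles of the bag stay put, counts the copies of [K];
   invariance of [V] makes all the copies in [G] look alike. When the bag is
   [[set b]] no other pebble is left, and the multiset of all colors is used instead. *)
Lemma approx_count i b :
    b \in X i -> {in cmp set0 b, forall y, y \in X i -> y = b} ->
  #|[set y : G | approx b y]| <= #|[set y : H | approx b y]|.
Proof.
move=> bi onlyb.
have [u [j [jF uj uX uN]]] := tuple_of_bag bi (width_V (capX i)).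
have approx_of (q : {ffun 'I_k -> G}) (v : {ffun 'I_k -> H}) :
    q @: F = X i -> q j = b -> col q = col' v -> approx b (v j).
  move=> qX qj qv; have [phi [iso phi_q phi_c]] := touched_iso qv qX.
  have := phi_c j jF; rewrite -(phi_q j jF) qj => im; apply: approx_map (im) (cmp_refl _ _).
  apply: iso_onS iso; rewrite -qj; apply: touched_closed.
  by apply: (subsetP (bag_touched q)); apply: imset_f.
have [Xb|] := eqVneq (X i :\ b) set0.
  (* Constant tuples stand for vertices: for each copy [x] of [b], an automorphism gives [cst x] the
     color of [cst b], so its partner under [mate] is constant too. *)
  pose cst x : {ffun 'I_k -> G} := [ffun => x].
  have cstX : cst b @: F = X i.
    rewrite -(setD1K bi) Xb setU0; apply/setP=> x; rewrite inE; apply/imsetP/eqP=> [[l _ ->]|->].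
      by rewrite ffunE.
    by exists j; rewrite // ffunE.
  have cst_col x : approx b x -> col (cst b) = col' (mate (cst x)).
    move=> bx; have [alpha [a_iso ab _]] := approx_automorphism bx.
    rewrite -mateE (wl_iso _ _ _ a_iso (autV a_iso)); congr (wl _ _ _ _).
    by apply/ffunP=> l; rewrite !ffunE.
  have mate_cst x l : approx b x -> mate (cst x) l = mate (cst x) j.
    move=> bx; have bV : cst b \in Vplus w k V by rewrite in_Vplus cstX.
    have [_ /(_ bV)[iso _]] := bisR (cst_col x bx).
    by apply/eqP; rewrite -(iso_typeE _ _ iso).1 !ffunE.
  apply: (leq_card_inj (f := fun x => mate (cst x) j)) => [x y|x]; rewrite !inE => bx.
    move=> by_ xy; have /(bij_inj mate_bij)/ffunP/(_ j) : mate (cst x) = mate (cst y).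
      by apply/ffunP=> l; rewrite !mate_cst.
    by rewrite !ffunE.
  by apply: (approx_of _ _ cstX _ (cst_col x bx)); rewrite ffunE.
move=> Xb; pose v := mate u; have uv : col u = col' v := mateE u.
have uV : u \in Vplus w k V by rewrite in_Vplus uX.
have [f f_bij [fR _ _ fcmp]] := game bisR uv uV.
have [phi [iso phi_u phi_c]] := touched_iso uv uX.
(* Copies whose component meets a bag pebble other than [j] are mapped by [phi], the others by [f];
   images cannot collide, as [f] respects this distinction. *)
pose near x := [exists l in F :\ j, x \in cmp set0 (u l)].
have nearP x : reflect (exists2 l, l \in F :\ j & x \in cmp set0 (u l)) (near x).
  exact: exists_inP.
have f_near x l : l \in F :\ j -> f x \in cmp set0 (v l) -> near x.
  move=> lFj fx; have [lj lF] := setD1P lFj; apply/nearP; exists l => //.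
  have := fcmp set0 l x (sub0set _) (bag_pos_neq lF (free2N w)).
  by rewrite !imset0 fx.
have near_touched x : near x -> x \in touched u.
  by case/nearP=> l /setD1P[_ lF] xl; apply/touchedP; exists l.
have phi_near x : near x -> exists2 l, l \in F :\ j & phi x \in cmp set0 (v l).
  case/nearP=> l lFj xl; have [_ lF] := setD1P lFj; exists l => //.
  by rewrite -phi_c // imset_f.
apply: (leq_card_inj (f := fun x => if near x then phi x else f x)) => [x y _ _|x].
  case: ifPn => nx; case: ifPn => ny.
  - by apply: (iso_on_inj iso); apply: near_touched.
  - have [l lFj pl] := phi_near x nx => xy; case/negP: ny.
    by apply: f_near lFj _; rewrite -xy.
  - have [l lFj pl] := phi_near y ny => xy; case/negP: nx.
    by apply: f_near lFj _; rewrite xy.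
  - exact: bij_inj f_bij _ _.
rewrite !inE => bx; case: ifPn => [nx|nx].
  apply: approx_trans bx _; have /nearP[l /setD1P[_ lF] xl] := nx.
  apply: approx_map (_ : phi @: cmp set0 (u l) = _) xl; last by rewrite phi_u ?phi_c.
  by apply: iso_onS iso; apply/touched_closed/(subsetP (bag_touched u))/imset_f.
(* [alpha] carries [b] to [x] and fixes every other pebble, so moving [j] to [x] does not change the
   color of [u]. *)
have [alpha [a_iso ab a_id]] := approx_automorphism bx.
have colx : col u = col' (subst v j (f x)).
  rewrite -fR (wl_iso _ _ _ a_iso (autV a_iso)); congr (wl _ _ _ _).
  apply/ffunP=> l; rewrite substE ffunE; case: eqVneq => [->|lj]; first by rewrite uj.
  have ul := uN l lj Xb; have [ulb uli] := setD1P ul; apply: a_id.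
    by apply: contra ulb => ulb; rewrite (onlyb _ ulb).
  apply: contra nx => ulx; have : u l \in u @: F by rewrite uX.
  case/imsetP=> m mF ulm; apply/nearP; exists m; last by rewrite -ulm cmp_sym.
  by rewrite in_setD1 mF andbT; apply: contraNneq ulb => mj; rewrite ulm mj uj.
by have := approx_of u _ uX uj colx; rewrite substE eqxx.
Qed.

(** On a tree walk from [i] to a bag of [x], some step enters a bag meeting the component from one
    that misses it; semi-smoothness allows only one new vertex there. *)
Lemma first_bag i x : [disjoint cmp set0 x & X i] ->
  exists t b, [/\ b \in cmp set0 x, b \in X t
                & {in cmp set0 b, forall y, y \in X t -> y = b}].
Proof.
move=> disj; have [[_ conn _] bag _ _] := decX; have [s xs] := bag x.
pose meets t := [exists y in cmp set0 x, y \in X t].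
have [/existsP[p /existsP[q /and3P[pq pN /exists_inP[b bx bq]]]]|none] :=
  boolP [exists p, exists q, [&& edge p q, ~~ meets p & meets q]].
  exists q, b; split=> // y yb yq; have yx := cmp_trans bx yb.
  have notp z : z \in cmp set0 x -> z \in X q -> z \in X q :\: X p.
    move=> zx zq; rewrite in_setD zq andbT; apply: contra pN => zp.
    by apply/exists_inP; exists z.
  have le1 : #|X q :\: X p| <= 1.
    have := smX pq; rewrite -subn1 leq_subLR geq_max => /andP[_ leq].
    by rewrite cardsD leq_subLR addnC [X q :&: _]setIC.
  by apply: (card_le1_eqP le1); apply: notp.
have /connectP[p pP last_p] := conn i s (in_setT i) (in_setT s).
suff : ~~ meets s by case/negP; apply/exists_inP; exists x; rewrite ?cmp_refl.
have iN : ~~ meets i.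
  by apply/exists_inPn=> y yx; rewrite (disjointFr disj yx).
rewrite last_p; elim: p i iN pP {disj last_p} => //= q p IHp i iN /andP[/and3P[_ _ iq] pP].
apply: IHp pP; apply: contra none => qM.
by apply/existsP; exists i; apply/existsP; exists q; rewrite iq iN.
Qed.

(** The bag [X i] fixes the isomorphism on the components it touches; all other components are
    copied whole, matched by counting rooted copies. *)
Lemma isomorphic_of_mate : #|G| = #|H| -> isomorphic G H.
Proof.
move=> eqGH; have [sigma _] := card_bijection eqGH.
have [[T_gt0 _ _] _ _ _] := decX; have [i _] := card_gt0P T_gt0.
have [B [B' [phi [[B_iso iB] Bcl B'cl phiB Bcount]]]] :
    exists (B : {set G}) (B' : {set H}) (phi : G -> H),
    [/\ iso_on B phi /\ X i \subset B,
        {in B, forall x, cmp set0 x \subset B},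
        {in B', forall y, cmp set0 y \subset B'},
        {in B, forall x, phi x \in B'}
      & forall b : G, #|[set y in B | approx b y]| = #|[set y in B' | approx b y]|].
  have [Xi0|[b bi]] := set_0Vmem (X i).
    exists set0, set0, sigma; split=> [|x|x|x|b]; rewrite ?inE //.
      by split; [apply/iso_onP=> x y; rewrite inE | rewrite Xi0].
    by rewrite !eq_card0 // => y; rewrite !inE.
  have [u [j [_ _ uX _]]] := tuple_of_bag bi (width_V (capX i)).
  have [phi [iso phi_u phi_c]] := touched_iso (mateE u) uX.
  have im : phi @: touched u = touched (mate u).
    apply/setP=> y; apply/imsetP/touchedP => [[x /touchedP[l lF xl] ->]|[l lF]].
      by exists l; rewrite // -phi_c // imset_f.
    rewrite -phi_c // => /imsetP[x xl ->]; exists x => //.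
    by apply/touchedP; exists l.
  exists (touched u), (touched (mate u)), phi; split.
  - by rewrite -uX bag_touched.
  - exact: touched_closed.
  - exact: touched_closed.
  - by move=> x xu; rewrite -im imset_f.
  move=> c; apply: eq_card_image (iso_on_inj iso) im _ => x /touchedP[l lF xl].
  have xx' : approx x (phi x).
    apply: approx_map (_ : phi @: cmp set0 (u l) = _) xl; last by rewrite phi_u ?phi_c.
    by apply: iso_onS iso; apply/touched_closed/(subsetP (bag_touched u))/imset_f.
  exact: approx_eqr.
(* A color is the set of vertices of [G] with an isomorphic rooted component, a value comparable
   across both graphs. *)
pose chi (K : sgraph) (x : K) := [set z : G | approx z x].
have chiE (K : sgraph) (y : K) (b : G) : (chi K y == chi G b) = approx b y.
  apply/eqP/idP => [/setP/(_ b)|by_]; first by rewrite !inE approx_refl.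
  by apply/setP=> z; rewrite !inE (approx_eqr z by_).
have clC (K : sgraph) (D : {set K}) : {in D, forall x, cmp set0 x \subset D} ->
    {in ~: D, forall x, cmp set0 x \subset ~: D}.
  move=> Dcl x; rewrite in_setC => xD; apply/subsetP=> y yx; rewrite in_setC.
  by apply: contra xD => yD; apply: (subsetP (Dcl y yD)); rewrite cmp_sym.
have disj0 (K : sgraph) (D : {set K}) : [disjoint D & set0].
  by rewrite disjoint_sym; apply/pred0P=> z; rewrite /= inE.
have iso0 : iso_on set0 sigma by apply/iso_onP=> x y; rewrite inE.
have [|x x' xB xB' /esym/eqP|psi [psi_iso _ psiB]] :=
  glue (chi := @chi G) (chi' := @chi H) (A := ~: B) (A' := ~: B') iso0
    (disj0 _ _) (disj0 _ _) (clC _ _ Bcl) (clC _ _ B'cl).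
(* The representative [b] is the only vertex of its component in some bag; the equally many copies
   inside [B] and [B'] cancel from the global count. *)
- move=> x; rewrite in_setC => xB; have [|t [b [bx bt onlyb]]] := first_bag (i := i) (x := x).
    rewrite disjoint_subset; apply/subsetP=> y yx; rewrite inE; apply: contra xB => yi.
    by apply: (subsetP (Bcl y (subsetP iB y yi))); rewrite cmp_sym.
  exists b => //; have := approx_count bt onlyb.
  have split_card (K : sgraph) (D : {set K}) :
      #|[set y : K | approx b y]| =
      #|[set y in D | approx b y]| + #|[set y in ~: D | chi K y == chi G b]|.
    rewrite -(cardsID D); congr (_ + _); apply: eq_card => y; rewrite !inE ?chiE //.
    by rewrite andbC.
  by rewrite (split_card G B) (split_card H B') Bcount leq_add2l.
- rewrite chiE => /approxP[phi1 [iso1 im1 phi1x]]; exists phi1; split.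
  + by rewrite set0U.
  + by move=> y; rewrite inE.
  + by move=> y yx; rewrite -im1 imset_f.
  move=> c; apply: (eq_card_image (iso_on_inj iso1) im1) => y yx.
  congr (_ == _); apply/setP=> z; rewrite !inE; apply: approx_eqr.
  by apply: (approx_map iso1 _ yx); rewrite im1 phi1x.
exists (piecewise B phi psi).
apply: iso_on_setT => //; rewrite -(setUCr B); apply: piecewise_iso => //.
  - by apply: iso_onS psi_iso; rewrite set0U.
  - by move=> y; rewrite in_setI in_setC andbN.
  move=> x y; rewrite !(in_setD, in_setC) => /andP[_ xB] /andP[_ yB].
  have xB' := phiB x xB; have yB' : psi y \notin B' by rewrite -in_setC psiB ?in_setC.
  split.
  - apply: contra yB => xy; apply: (subsetP (Bcl x xB)).
    exact: cmp0_edge (cmp_refl _ _) xy.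
  - by apply: contraNneq yB' => <-.
  - apply: contra yB' => xy; apply: (subsetP (B'cl _ xB')).
    exact: cmp0_edge (cmp_refl _ _) xy.
Qed.

End Touched.

(** * Deciding isomorphism by stable colors *)

Theorem theorem2 (C : sgraph -> Prop) (k' : nat) (V : forall G : sgraph, set_family G) :
  1 <= k' ->
  iso_invariant C V ->
  (forall G : sgraph, C G -> width_at_most k' (V G)) ->
  (forall G : sgraph, C G ->
     exists (T : sgraph) (X : T -> {set G}),
       [/\ tree_decomposition X, semi_smooth X & captures (V G) X]) ->
  forall G G' : sgraph, C G -> C G' ->
    isomorphic G G' <-> same_stable_colors k' (k' + 3) (V G) (V G').
Proof.
move=> _ invV widthV decV G G' CG CG'; split=> [[f f_iso]|].
  exact: isomorphic_same_colors f_iso (invV G G' CG CG' f f_iso).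
move=> /multiset.eq_seq_msetP/perm_map_bijection[mate mate_bij mateE].
have [T [X [decX smX capX]]] := decV G CG.
have := isomorphic_of_mate (@wl_bisim k' _ _ _ (V G) (V G')) (widthV G CG) decX smX capX
  (invV G G CG CG) mate_bij mateE; apply.
(* Both graphs have equally many tuples, hence equally many vertices, as the exponent [k' + 3] is
   positive. *)
have := bij_eq_card mate_bij; rewrite !card_ffun !card_ord => /eqP.
by rewrite eqn_exp2r ?addn3 // => /eqP.
Qed.
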